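(* Let $\Gamma^{BM}_r$ ($r\in\{o,p,k\}$) and $\Gamma^{OD}_{t,q}$ ($t\in\{o,p\}$, $q\in\{l,k\}$) denote the classes of $\Gamma^{BM}_r$-spaces and of $\Gamma^{OD}_{t,q}$-spaces, respectively. (1) The following inclusions hold: $\Gamma^{BM}_o\subset\Gamma^{OD}_{o,l}$, $\Gamma^{BM}_k\subset\Gamma^{OD}_{p,k}$, $\Gamma^{BM}_p\subset\Gamma^{OD}_{p,l}$, $\Gamma^{OD}_{p,k}\subset\Gamma^{OD}_{o,k}$, $\Gamma^{OD}_{p,k}\subset\Gamma^{OD}_{p,l}$, $\Gamma^{OD}_{o,k}\subset\Gamma^{OD}_{o,l}$, $\Gamma^{OD}_{p,l}\subset\Gamma^{OD}_{o,l}$. (2) Let $t\in\{o,p\}$, let $X$ be a $\Gamma^{OD}_{t,k}$-space and $Y$ a $\Gamma^{OD}_{t,l}$-space. Then $X\times Y$ is a $\Gamma^{OD}_{t,l}$-space. (3) Let $D$ be an index set, and let $X_\delta$ be a $\Gamma^{OD}_{o,k}$-space for each $\delta\in D$. Then $\prod_{\delta\in D}X_\delta$ is a $\Gamma^{OD}_{o,k}$-space. (4) Let $X_n$ be a $\Gamma^{OD}_{p,k}$-space for each $n\in\omega$. Then $\prod_{n\in\omega}X_n$ is a $\Gamma^{OD}_{p,k}$-space. (5) For $t\in\{o,p\}$ and $q\in\{l,k\}$, if $X\in\Gamma^{OD}_{t,q}$ and $U\subset X$ is an open subspace, then $U\in\Gamma^{OD}_{t,q}$. (6) For $t\in\{o,p\}$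 and $q\in\{l,k\}$, if $X$ is locally $\Gamma^{OD}_{t,q}$ (i.e. every point has a neighborhood $U\in\Gamma^{OD}_{t,q}$), then $X\in\Gamma^{OD}_{t,q}$. (7) Let $X$ be a quasi-regular space. - If $X$ is a metrizable space, a Moore space, a developable space, a semiregular $\sigma$-space, a semiregular space with a countable network, a compact space, a $p$-space, or a semiregular strong $\Sigma$-space, then $X$ is a $\Gamma^{OD}_{p,k}$-space. - If $X$ is a countably compact space, a semiregular $\Sigma$-space, or a $w\Delta$-space, then $X$ is a $\Gamma^{OD}_{p,l}$-space. - If $X$ is a feebly compact space, then $X$ is a $\Gamma^{OD}_{o,l}$-space.
   Context: Let $\mathcal T$ be the topology of $X$, $\mathcal T^*=\mathcal T\setminus\{\varnothing\}$, $\omega=\{0,1,2,\dots\}$. $\mathfrak V(X)$: all sequences $(V_n)_{n\in\omega}$ in $\mathcal T^*$ with $V_{n+1}\subset V_n$. $\mathfrak V_{BM}(X)$: those $(V_n)\in\mathfrak V(X)$ with $\bigcap_nV_n\ne\varnothing$; $\mathfrak V_{BM}^*(X)=\mathfrak V(X)\setminus\mathfrak V_{BM}(X)$. $\mathfrak W(X)$: all sequences $(V_n,M_n)_{n\in\omega}$ with $V_n\in\mathcal T^*$, $\varnothing\neq M_n\subset X$, $V_{n+1}\subset V_n$, $M_{n+1}\subset V_n$. $\mathfrak W_e(X)$: those members of $\mathfrak W(X)$ with $\bigcap_nV_n=\varnothing$. For subsets $M_n\subset X$, $\overline{\mathrm{lt}}_{n}M_n$ is the set of $x\in X$ such that every neighborhood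 of $x$ meets $M_n$ for infinitely many $n$. For a nonprincipal ultrafilter $p$ on $\omega$ ($p\in\omega^*$), $x=\lim_p x_n$ means $\{n:x_n\in U\}\in p$ for every neighborhood $U$ of $x$. $\mathfrak W_l(X)$: those $(V_n,M_n)\in\mathfrak W(X)$ with $\overline{\mathrm{lt}}_nM_n\cap\bigcap_nV_n\neq\varnothing$. $\mathfrak W_k(X)$: those $(V_n,M_n)\in\mathfrak W(X)$ for which there are points $x_n\in M_n$ ($n\in\omega$) such that for every $p\in\omega^*$ there is $x\in\bigcap_nV_n$ with $x=\lim_px_n$. $\mathcal N_o(X)=\mathcal T^*$, $\mathcal N_p(X)=\{\{x\}:x\in X\}$. For $t\in\{o,p\}$, $\mathfrak V_t(X)$ is the set of $(V_n)\in\mathfrak V(X)$ such that $(V_n,M_n)_n\in\mathfrak W_l(X)$ whenever $M_n\in\mathcal N_t(X)$ and $M_n\subset V_n$ for all $n$. $\mathfrak V_k(X)$: those $(V_n)\in\mathfrak V_{BM}(X)$ such that $M=\bigcap_nV_n$ is compact and $\{V_n\}$ is an outer base of $M$ (every open $W\supset M$ contains some $V_n$). Games (two players $\alpha$, $\beta$; strategies may depend on all previous moves). For $\mathcal V\subset\mathfrak V(X)$, in $BM(X,\mathcal V)$ player $\alpha$ starts with $U_0=X$; $\beta$ answers $V_0\in\mathcal T^*$, $V_0\subset U_0$; on move $n\ge1$, $\alpha$ chooses $U_n\in\mathcal T^*$, $U_n\subset V_{n-1}$, then $\beta$ chooses $V_n\in\mathcal T^*$, $V_n\subset U_n$; $\alpha$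 wins if $(V_n)\in\mathcal V$, otherwise $\beta$ wins. For $\mathcal N\in\{\mathcal N_o(X),\mathcal N_p(X)\}$ and $\mathcal W\subset\mathfrak W(X)$, $OD(X,\mathcal N,\mathcal W)$ is played like $BM$, except that on every move $n$ player $\beta$ also chooses $M_n\in\mathcal N$ with $M_n\subset U_n$, and $\alpha$ wins if $(V_n,M_n)\in\mathcal W$, otherwise $\beta$ wins. $X$ is a $\Gamma^{BM}_r$-space if $\alpha$ has a winning strategy in $BM(X,\mathfrak V_r(X)\cup\mathfrak V_{BM}^*(X))$. $X$ is a $\Gamma^{OD}_{t,q}$-space if $\alpha$ has a winning strategy in $OD(X,\mathcal N_t(X),\mathfrak W_q(X)\cup\mathfrak W_e(X))$. Quasi-regular: every nonempty open $U$ contains the closure of some nonempty open $V$. Semiregular: there is a base consisting of sets $U$ with $U=\operatorname{Int}\overline U$. Feebly compact: every locally finite family of open sets is finite. For a family $\gamma$ of sets, $\mathrm{st}(x,\gamma)=\bigcup\{U\in\gamma:x\in U\}$. Developable: there are open covers $\gamma_n$ ($n\in\omega$) such that for each $x$ the family $\{\mathrm{st}(x,\gamma_n):n\in\omega\}$ is a base at $x$. Classical classes of generalized metric spaces: a Moore space is a regular developable space; a network is a family of sets such that each open set is a union of members of it; a $\sigma$-space is a space having a network that is a countable union of locally finite families; a $\Sigma$-space (strong $\Sigma$-space) is a space with a $\sigma$-discrete family $\mathcal F$ of closed sets and a cover $\mathcal C$ by closed countably compact (resp. compact) sets such that whenever $C\in\mathcal C$, $C\subset U$, $U$ open, there is $F\in\mathcal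 F$ with $C\subset F\subset U$; a $w\Delta$-space is a space with open covers $\mathcal G_n$ such that whenever $x_n\in\mathrm{st}(x,\mathcal G_n)$ for all $n$, the sequence $(x_n)$ has a cluster point; a $p$-space is a completely regular space $X$ for which there are families $\mathcal U_n$ ($n\in\omega$) of open subsets of $\beta X$ (Stone-Čech compactification), each covering $X$, with $\bigcap_n\mathrm{st}(x,\mathcal U_n)\subset X$ for all $x\in X$. *)

(* Defs.v *)
(* MathComp-Analysis *)
From HB Require Import structures.
From mathcomp Require Import all_boot all_order all_algebra.
From mathcomp Require Import all_classical all_reals all_analysis.

Set Implicit Arguments.
Unset Strict Implicit.
Unset Printing Implicit Defensive.

Local Open Scope classical_set_scope.

(** * Indices of the classes [Gamma^BM_r] and [Gamma^OD_{t,q}] *)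

Variant tkind := t_o | t_p.
Variant qkind := q_l | q_k.
Variant rkind := r_o | r_p | r_k.

(** * Spaces of sequences of sets *)

(* [A] is a nonempty open subset of [B]. *)
Definition nonempty_open_in (X : topologicalType) (A B : set X) : Prop :=
  [/\ open A, A !=set0 & A `<=` B].

Definition frakV (X : topologicalType) : set (nat -> set X) :=
  [set V | (forall n, open (V n) /\ V n !=set0) /\
           (forall n, V n.+1 `<=` V n)].

Definition frakV_BM (X : topologicalType) : set (nat -> set X) :=
  [set V | frakV V /\ \bigcap_n V n !=set0].

Definition frakV_BM_star (X : topologicalType) : set (nat -> set X) :=
  @frakV X `\` @frakV_BM X.

(* The sequence (V_n, M_n)_n is [w], with [V_n = (w n).1], [M_n = (w n).2]. *)
Definition frakW (X : topologicalType) : set (nat -> set X * set X) :=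
  [set w | [/\ forall n, open (w n).1 /\ (w n).1 !=set0,
               forall n, (w n).2 !=set0,
               forall n, (w n.+1).1 `<=` (w n).1 &
               forall n, (w n.+1).2 `<=` (w n).1]].

Definition frakW_e (X : topologicalType) : set (nat -> set X * set X) :=
  [set w | frakW w /\ \bigcap_n (w n).1 = set0].

Definition upper_lt (X : topologicalType) (M : nat -> set X) : set X :=
  [set x | forall U, nbhs x U -> infinite_set [set n | M n `&` U !=set0]].

Definition omega_star : set (set_system nat) :=
  [set p | UltraFilter p /\ forall n, p <> principal_filter n].

Definition frakW_l (X : topologicalType) : set (nat -> set X * set X) :=
  [set w | frakW w /\
    upper_lt (fun n => (w n).2) `&` \bigcap_n (w n).1 !=set0].

Definition frakW_k (X : topologicalType) : set (nat -> set X * set X) :=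
  [set w | frakW w /\
    exists2 u : nat -> X, (forall n, (w n).2 (u n)) &
      forall p : set_system nat, omega_star p ->
        exists2 x, (\bigcap_n (w n).1) x & u @ p --> x].

Definition frakW_ (X : topologicalType) (q : qkind) :
    set (nat -> set X * set X) :=
  match q with q_l => @frakW_l X | q_k => @frakW_k X end.

Definition calN (X : topologicalType) (t : tkind) : set (set X) :=
  match t with
  | t_o => [set M | open M /\ M !=set0]
  | t_p => [set M | exists x, M = [set x]]
  end.

Definition frakV_t (X : topologicalType) (t : tkind) : set (nat -> set X) :=
  [set V | frakV V /\
    forall M : nat -> set X,
      (forall n, calN t (M n)) -> (forall n, M n `<=` V n) ->
      frakW_l (fun n => (V n, M n))].

Definition frakV_k (X : topologicalType) : set (nat -> set X) :=
  [set V | [/\ frakV_BM V, compact (\bigcap_n V n) &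
    forall W, open W -> \bigcap_n V n `<=` W -> exists n, V n `<=` W]].

Definition frakV_ (X : topologicalType) (r : rkind) : set (nat -> set X) :=
  match r with
  | r_o => frakV_t t_o
  | r_p => frakV_t t_p
  | r_k => @frakV_k X
  end.

(** * Games *)

(* A strategy of the first player maps the list of all previous rounds, oldest
   first, to the next move.  A winning one must answer legally after each finite
   stage at which the opponent has only made legal moves, and win the infinite
   plays; the opening move [X] is imposed, even when [X] is empty (in which case
   the opponent cannot move). *)

Definition BM_strategy (X : topologicalType) := seq (set X * set X) -> set X.

Definition BM_winning (X : topologicalType) (calV : set (nat -> set X))
    (s : BM_strategy X) : Prop :=
  forall U V : nat -> set X,
    U 0 = setT ->
    (forall n, U n.+1 = s (mkseq (fun i => (U i, V i)) n.+1)) ->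
    (forall n, (forall i, i <= n -> nonempty_open_in (V i) (U i)) ->
       nonempty_open_in (U n.+1) (V n)) /\
    ((forall n, nonempty_open_in (V n) (U n)) -> calV V).

Definition Gamma_BM (r : rkind) (X : topologicalType) : Prop :=
  exists s : BM_strategy X, BM_winning (@frakV_ X r `|` @frakV_BM_star X) s.

(* A round is [(U_i, (V_i, M_i))]. *)
Definition OD_strategy (X : topologicalType) :=
  seq (set X * (set X * set X)) -> set X.

Definition OD_reply (X : topologicalType) (N : set (set X))
    (V M U : set X) : Prop :=
  [/\ nonempty_open_in V U, N M & M `<=` U].

Definition OD_winning (X : topologicalType) (N : set (set X))
    (calW : set (nat -> set X * set X)) (s : OD_strategy X) : Prop :=
  forall U V M : nat -> set X,
    U 0 = setT ->
    (forall n, U n.+1 = s (mkseq (fun i => (U i, (V i, M i))) n.+1)) ->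
    (forall n, (forall i, i <= n -> OD_reply N (V i) (M i) (U i)) ->
       nonempty_open_in (U n.+1) (V n)) /\
    ((forall n, OD_reply N (V n) (M n) (U n)) -> calW (fun n => (V n, M n))).

Definition Gamma_OD (t : tkind) (q : qkind) (X : topologicalType) : Prop :=
  exists s : OD_strategy X,
    OD_winning (@calN X t) (@frakW_ X q `|` @frakW_e X) s.

(** * Classes of spaces *)

Definition quasi_regular (X : topologicalType) : Prop :=
  forall U : set X, open U -> U !=set0 ->
    exists V : set X, [/\ open V, V !=set0 & closure V `<=` U].

Definition semiregular (X : topologicalType) : Prop :=
  exists2 B : set (set X), basis B & forall U, B U -> regopen U.

Definition locally_finite (X : topologicalType) (F : set (set X)) : Prop :=
  forall x : X, exists2 U, nbhs x U & finite_set [set A | F A /\ A `&` U !=set0].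

Definition discrete_family (X : topologicalType) (F : set (set X)) : Prop :=
  forall x : X, exists2 U, nbhs x U &
    forall A B, F A -> F B -> A `&` U !=set0 -> B `&` U !=set0 -> A = B.

Definition feebly_compact (X : topologicalType) : Prop :=
  forall F : set (set X), (forall A, F A -> open A) ->
    locally_finite F -> finite_set F.

(* [cover_compact] restricted to countable covers *)
Definition countably_compact (X : topologicalType) (A : set X) : Prop :=
  forall f : nat -> set X, (forall n, open (f n)) ->
    A `<=` cover setT f -> finite_subset_cover setT f A.

Definition open_cover (X : topologicalType) (G : set (set X)) : Prop :=
  (forall A, G A -> open A) /\ \bigcup_(A in G) A = setT.

Definition st (T : Type) (x : T) (G : set (set T)) : set T :=
  \bigcup_(A in [set A | G A /\ A x]) A.

Definition base_at (X : topologicalType) (x : X) (B : set (set X)) : Prop :=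
  (forall A, B A -> open_nbhs x A) /\
  (forall U, nbhs x U -> exists2 A, B A & A `<=` U).

Definition developable (X : topologicalType) : Prop :=
  exists G : nat -> set (set X), (forall n, open_cover (G n)) /\
    forall x, base_at x [set st x (G n) | n in [set: nat]].

Definition moore_space (X : topologicalType) : Prop :=
  regular_space X /\ developable X.

Definition metrizable (R : realType) (X : topologicalType) : Prop :=
  exists (M : metricType R) (f : X -> M) (g : M -> X),
    [/\ cancel f g, cancel g f, continuous f & continuous g].

Definition network (X : topologicalType) (N : set (set X)) : Prop :=
  forall U, open U -> exists2 N' : set (set X), N' `<=` N &
    U = \bigcup_(A in N') A.

Definition has_countable_network (X : topologicalType) : Prop :=
  exists2 N : set (set X), countable N & network N.

Definition sigma_space (X : topologicalType) : Prop :=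
  exists2 N : nat -> set (set X), (forall n, locally_finite (N n)) &
    network (\bigcup_n N n).

(* Common form of Sigma-spaces and strong Sigma-spaces: [K] is the compactness
   property required of the members of the cover [C]; the sigma-discrete family
   is the union of the [F n]. *)
Definition Sigma_space_for (X : topologicalType) (K : set X -> Prop) : Prop :=
  exists (F : nat -> set (set X)) (C : set (set X)),
    [/\ forall n, discrete_family (F n),
        forall n A, F n A -> closed A,
        forall A, C A -> closed A /\ K A,
        \bigcup_(A in C) A = setT &
        forall A U, C A -> open U -> A `<=` U ->
          exists2 B, (\bigcup_n F n) B & A `<=` B /\ B `<=` U].

Definition Sigma_space (X : topologicalType) : Prop :=
  Sigma_space_for (@countably_compact X).

Definition strong_Sigma_space (X : topologicalType) : Prop :=
  Sigma_space_for (@compact X).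

Definition wDelta_space (X : topologicalType) : Prop :=
  exists2 G : nat -> set (set X), (forall n, open_cover (G n)) &
    forall (x : X) (u : nat -> X), (forall n, st x (G n) (u n)) ->
      cluster (u @ \oo) !=set0.

(* [e : X -> B] is the Stone-Cech compactification of [X]: a dense embedding in a
   compact Hausdorff space with the universal extension property. *)
Definition stone_cech (X B : topologicalType) (e : X -> B) : Prop :=
  [/\ compact [set: B] /\ hausdorff_space B,
      injective e,
      @open X = @open (initial_topology e),
      dense (range e) &
      forall (K : topologicalType) (f : X -> K),
        compact [set: K] -> hausdorff_space K -> continuous f ->
        exists2 g : B -> K, continuous g & forall x, g (e x) = f x].

Definition p_space (X : topologicalType) : Prop :=
  completely_regular_space X /\
  exists (B : topologicalType) (e : X -> B), stone_cech e /\
    exists U : nat -> set (set B),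
      [/\ forall n A, U n A -> open A,
          forall n, range e `<=` \bigcup_(A in U n) A &
          forall x, \bigcap_n st (e x) (U n) `<=` range e].

(* Main.v *)
Require Import Defs.
From mathcomp Require Import all_boot all_order all_algebra finmap.
From mathcomp Require Import all_classical all_reals all_analysis.

(** The permanence properties are proved by combining strategies of the first player,
which is easy once a strategy may keep a memory of its own choice.  A [plan] is a
transition system whose positions carry that memory; [Gamma_ODP] identifies the
classes [Gamma_OD] with the existence of a winning plan, so that histories of moves
are handled once and for all.  Since every legal play already lies in the ambient
space of sequences, winning means ([payoffP]): if the sets [V n] have a common point,
then the sets [M n] accumulate at one, in the sense of [limiting].

Permanence.  In a product of two spaces both games are played side by side on
boxes.  A point of the upper limit in the second factor is a limit along some free
ultrafilter ([upper_lt_ultra]), and along the same ultrafilter the points selected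
in the first factor converge; this proves the product theorem for [q_k] times
[q_l].  In an infinite product ([Gamma_OD_prod]) the offered boxes must stay open,
so a coordinate enters the game only when it becomes constrained by an open set, or,
if the product is countable, when its turn comes; the rounds it misses are finite in
number, and dropping them only replaces each free ultrafilter by its image under a
shift ([cvg_delay]).  Open subspaces and local properties follow by carrying plans
along the inclusion of a subspace, the first answer of the opponent being used, in
the local case, to select a small subspace.

Examples.  Here stationary strategies suffice: [U n.+1] depends on [n] and [V n]
only.  Quasi-regularity allows the closure of [U n.+1] to lie in [V n], which puts
every accumulation point of the play in all the [V n]; it remains to force
accumulation.  Compactness properties of the whole space do this directly.  With
open covers, in the space itself or in a compactification, [U n.+1] is chosen
inside a member of the [n]-th cover, hence inside its star at any common point.
With locally finite families, [U n.+1] can be shrunk until each member of the [n]-th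
family misses it or is dense in it ([locally_finite_settle]).  If these families
form a network of a semiregular space, the sets [U n] then form a base at every
common point; if they are the families of closed sets of a Sigma-space, the sets
[U n] shrink to a member of the associated cover, which attracts the points played
([compact_attracts], [countably_compact_attracts]). *)

Set Implicit Arguments.
Unset Strict Implicit.
Unset Printing Implicit Defensive.

Import Order.TTheory GRing.Theory Num.Theory.

Local Open Scope classical_set_scope.

(** * Free ultrafilters and limits of sequences *)

Lemma infinite_natP (A : set nat) :
  infinite_set A <-> forall k, exists2 n, k <= n & A n.
Proof.
split=> [Ainf k|Aunb].
  apply: contrapT => nA; apply: Ainf.
  apply: (@sub_finite_set _ _ `I_k) (finite_II k) => n An /=.
  by rewrite ltnNge; apply/negP => kn; apply: nA; exists n.
move=> /finite_seqP[s As].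
have [n] := Aunb (\max_(i <- s) i).+1.
rewrite As /= => + ns.
by rewrite ltnNge leq_bigmax_seq.
Qed.

Lemma omega_star_cofinite (p : set_system nat) k :
  omega_star p -> p [set n | k <= n].
Proof.
move=> [pU pN]; elim: k => [|k IH]; first by apply: filterS filterT.
have [//|pk] := @in_ultra_setVsetC _ _ [set n | k < n] pU.
case: (pN k); have pk1 : p [set k].
  apply: filterS (filterI IH pk) => n [/= kn /negP]; rewrite -leqNgt => nk.
  by apply/eqP; rewrite eqn_leq kn nk.
apply: (max_filter (UltraFilter := principal_filter_ultra k)) => A Ak.
by apply: filterS pk1.
Qed.

Lemma omega_star_unbounded (p : set_system nat) A :
  omega_star p -> p A -> forall k, exists2 n, k <= n & A n.
Proof.
move=> pstar pA k; have [pU _] := pstar.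
have [n [/= An kn]] := filter_ex (filterI pA (omega_star_cofinite k pstar)).
by exists n.
Qed.

Lemma exists_omega_star (G : set_system nat) :
  ProperFilter G -> (forall k, G [set n | k <= n]) ->
  exists2 p, omega_star p & G `<=` p.
Proof.
move=> GF Gk; have [p [pU Gp]] := ultraFilterLemma GF.
exists p => //; split=> // n pn.
have := Gp _ (Gk n.+1); rewrite pn => /(_ n erefl) /=.
by rewrite ltnn.
Qed.

Lemma omega_star_map (p : set_system nat) k :
  omega_star p -> omega_star ((fun n => n - k) @ p).
Proof.
move=> pstar; have [pU _] := pstar; split.
  split; first exact: fmap_proper_filter.
  move=> G GF pG; apply/seteqP; split=> [A GA|]; last exact: pG.
  have [//|pA] := @in_ultra_setVsetC _ _ ((fun n => n - k) @^-1` A) pU.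
  have /pG GA' : ((fun n => n - k) @ p) (~` A) by [].
  by have [x []] := filter_ex (filterI GA GA').
move=> n pn.
have : ((fun n => n - k) @ p) [set m | m = n] by rewrite pn.
move=> /(omega_star_unbounded pstar)/(_ (n + k).+1)[m nkm /= mkn].
by move: nkm; rewrite -mkn ltnNge addnC -leq_subLR leqnn.
Qed.

(** A limit along [p] ignores a delay of the sequence, at the price of moving
[p]: this is what lets a play that starts late be judged as a play of its own. *)
Lemma cvg_delay (X : topologicalType) (p : set_system nat) k (u v : nat -> X)
    (x : X) :
  omega_star p -> (forall n, v (n + k) = u n) ->
  u @ ((fun n => n - k) @ p) --> x -> v @ p --> x.
Proof.
move=> pstar vu ux A /ux; have [pU _] := pstar.
rewrite /= /nbhs /= => pA.
apply: filterS (filterI pA (omega_star_cofinite k pstar)) => n [/= + kn].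
by rewrite -vu subnK.
Qed.

Lemma upper_ltP (X : topologicalType) (M : nat -> set X) (x : X) :
  upper_lt M x <-> forall O, nbhs x O ->
    forall k, exists2 n, k <= n & M n `&` O !=set0.
Proof. by split=> Mx O xO; apply/infinite_natP; exact: Mx. Qed.

Lemma upper_lt_shift (X : topologicalType) (M : nat -> set X) k :
  upper_lt (fun n => M (n + k)) `<=` upper_lt M.
Proof.
move=> x /upper_ltP Mx; apply/upper_ltP => O /Mx MO j.
by have [n jn Mn] := MO j; exists (n + k) => //; rewrite (leq_trans jn)// leq_addr.
Qed.

Lemma upper_lt_cvg (X : topologicalType) (p : set_system nat) (u : nat -> X) (x : X)
    (M : nat -> set X) :
  omega_star p -> (forall n, M n (u n)) -> u @ p --> x -> upper_lt M x.
Proof.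
move=> pstar Mu ux; apply/upper_ltP => O /ux pO k.
have [n kn On] := omega_star_unbounded pstar pO k.
by exists n => //; exists (u n).
Qed.

(** The sets of indices at which [M] meets a given neighbourhood of a point of the
upper limit generate a filter; a free ultrafilter above it turns the upper limit
into a limit along an ultrafilter. *)
Lemma upper_lt_ultra (X : topologicalType) (M : nat -> set X) (x : X) :
  upper_lt M x -> exists2 p, omega_star p &
    forall O, nbhs x O -> p [set n | M n `&` O !=set0].
Proof.
move=> /upper_ltP Mx.
pose B (i : set X * nat) := [set n | M n `&` i.1 !=set0 /\ i.2 <= n].
have FB : ProperFilter (filter_from [set i | nbhs x i.1] B).
  apply: filter_from_proper; last first.
    by move=> [G k] /= /Mx/(_ k)[n kn MO]; exists n.
  apply: filter_from_filter; first by exists (setT, 0) => /=; exact: filterT.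
  move=> [A1 k1] [A2 k2] /= A1x A2x; exists (A1 `&` A2, maxn k1 k2) => /=.
    exact: filterI.
  move=> n [[y /= [My [A1y A2y]]]]; rewrite geq_max => /andP[k1n k2n].
  by split; split=> //; exists y.
have [|p pstar Bp] := exists_omega_star FB.
  by move=> k; exists (setT, k); [exact: filterT|move=> n []].
exists p => // O Ox; apply: Bp; exists (O, 0) => //.
by move=> n [].
Qed.

(** The closures in [C] of the sets of terms indexed by members of [p] are nonempty
since every neighbourhood of [C] contains almost all terms; a point common to all
of them is the limit. *)
Lemma compact_attracts (X : topologicalType) (C : set X) (u : nat -> X) :
  compact C ->
  (forall W, open W -> C `<=` W -> exists k, forall n, k <= n -> W (u n)) ->
  forall p, omega_star p -> exists2 y, C y & u @ p --> y.
Proof.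
move=> Cc Cu p pstar; have [pU _] := pstar.
pose B A := closure (u @` A) `&` C.
have FB : ProperFilter (filter_from p B).
  apply: filter_from_proper; last first.
    move=> A pA; apply: contrapT => /set0P/negP; rewrite negbK => /eqP BA0.
    have [||k kW] := Cu (~` closure (u @` A)).
    - exact/closed_openC/closed_closure.
    - by move=> y Cy Ay; have : B A y by []; rewrite BA0.
    have [n kn An] := omega_star_unbounded pstar pA k.
    by apply: (kW n kn); apply: subset_closure; exists n.
  apply: filter_from_filter; first by exists setT; exact: filterT.
  move=> A1 A2 pA1 pA2; exists (A1 `&` A2); first exact: filterI.
  move=> y [Ay Cy]; split; split=> //; apply: closureS Ay;
    by apply: image_subset => ? [].
have [|y [Cy yB]] := Cc _ FB.
  by exists setT; [exact: filterT|move=> y []].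
exists y => // O yO.
have [//|pO] := @in_ultra_setVsetC _ _ (u @^-1` O) pU.
have : filter_from p B (closure (u @` (u @^-1` (~` O)))).
  by exists (u @^-1` (~` O)) => // z [].
move: yO; rewrite nbhsE => -[G [Go Gy] GO] FO.
have [z [/= zcl Gz]] := yB _ _ FO (open_nbhs_nbhs (conj Go Gy)).
have [_ [[n nO <-] Gn]] := zcl _ (open_nbhs_nbhs (conj Go Gz)).
by case: nO; exact: GO.
Qed.

Lemma countably_compact_attracts (X : topologicalType) (C : set X)
    (u : nat -> X) :
  countably_compact C ->
  (forall W, open W -> C `<=` W -> exists k, forall n, k <= n -> W (u n)) ->
  exists2 y, C y & upper_lt (fun n => [set u n]) y.
Proof.
move=> Cc Cu; apply: contrapT => nlt.
pose W k := ~` closure (u @` [set n | k <= n]).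
have W_mono j k : j <= k -> W j `<=` W k.
  move=> jk; apply: subsetC; apply: closureS.
  by apply: image_subset => n /=; exact: leq_trans.
have [| |D _ CD] := Cc W.
- by move=> k; exact/closed_openC/closed_closure.
- move=> y Cy; apply: contrapT => nW; apply: nlt; exists y => //.
  apply/upper_ltP => O yO k.
  have : closure (u @` [set n | k <= n]) y.
    by apply: contrapT => Wy; apply: nW; exists k.
  by move=> /(_ O yO)[_ [[n kn <-] On]]; exists n => //; exists (u n).
pose m := \max_(k <- finmap.enum_fset D) k.
have CW : C `<=` W m.
  move=> y /CD[k /= kD]; apply: W_mono.
  by rewrite leq_bigmax_seq.
have [|k kW] := Cu (W m) _ CW; first exact/closed_openC/closed_closure.
apply: (kW (maxn k m)); first exact: leq_maxl.
by apply: subset_closure; exists (maxn k m) => //=; exact: leq_maxr.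
Qed.

(** * Plans: strategies with a private memory *)

Definition limiting (X : topologicalType) (q : qkind) (V M : nat -> set X) : Prop :=
  match q with
  | q_l => upper_lt M `&` \bigcap_n V n !=set0
  | q_k => exists2 u : nat -> X, (forall n, M n (u n)) &
      forall p, omega_star p -> exists2 x, (\bigcap_n V n) x & u @ p --> x
  end.

Definition payoff (X : topologicalType) (q : qkind) (V M : nat -> set X) : Prop :=
  \bigcap_n V n !=set0 -> limiting q V M.

Lemma payoffP (X : topologicalType) t q (U V M : nat -> set X) :
  (forall n, OD_reply (calN t) (V n) (M n) (U n)) ->
  (forall n, U n.+1 `<=` V n) ->
  (@frakW_ X q `|` @frakW_e X) (fun n => (V n, M n)) <-> payoff q V M.
Proof.
move=> rep UV.
have VMW : frakW (fun n => (V n, M n)).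
  split=> n /=; have [[Vo Vn VU] NM MU] := rep n => //.
  - by case: (t) NM => [[]|[x ->]] //; exists x.
  - by have [[_ _ VU1] _ _] := rep n.+1; apply: subset_trans (UV n).
  - by have [_ _ MU1] := rep n.+1; apply: subset_trans (UV n).
split=> [[Wq|[_ Ve]]|pay].
- by move=> _; case: q Wq => -[].
- by move=> [x]; rewrite Ve.
- have [V0|/eqP/set0P Vn] := pselect (\bigcap_n V n = set0); first by right.
  by left; case: q pay => /(_ Vn) lim; split.
Qed.

(** A plan of the first player keeps a position of an arbitrary type, which
determines the set offered to the opponent; [moves_to] is only a relation, so that
choices need not be made when plans are combined. *)
Record plan (X : topologicalType) := Plan {
  position : Type;
  start : position;
  valid : position -> Prop;
  offer : position -> set X;
  moves_to : position -> set X -> set X -> position -> Prop }.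

Definition step (X : topologicalType) (A : plan X) (p : position A)
    (V M : set X) (p' : position A) : Prop :=
  [/\ valid p', moves_to p V M p' & nonempty_open_in (offer p') V].

Record run (X : topologicalType) (A : plan X) (t : tkind)
    (p : nat -> position A) (V M : nat -> set X) : Prop := Run {
  run_start : p 0 = start A;
  run_reply : forall n, OD_reply (calN t) (V n) (M n) (offer (p n));
  run_step : forall n, step (p n) (V n) (M n) (p n.+1) }.

Record plan_wins (X : topologicalType) (t : tkind) (q : qkind) (W : set X)
    (A : plan X) : Prop := PlanWins {
  wins_valid : valid (start A);
  wins_offer : offer (start A) = W;
  wins_step : forall (p : position A) V M, valid p ->
    OD_reply (calN t) V M (offer p) -> exists p', step p V M p';
  wins_payoff : forall (p : nat -> position A) V M,
    run t p V M -> payoff q V M }.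

Definition Gamma_from (X : topologicalType) t q (W : set X) : Prop :=
  exists A : plan X, plan_wins t q W A.

Lemma run_offer (X : topologicalType) (A : plan X) t (p : nat -> position A) V M :
  run t p V M -> \bigcap_n offer (p n) = \bigcap_n V n.
Proof.
move=> pr; apply/seteqP; split=> x xn n _.
  by have [_ _ [_ _ oV]] := run_step pr n; apply/oV/xn.
by have [[_ _ Vo] _ _] := run_reply pr n; apply/Vo/xn.
Qed.

Lemma limiting_bigcap (X : topologicalType) q (V W M : nat -> set X) :
  \bigcap_n V n = \bigcap_n W n -> limiting q V M -> limiting q W M.
Proof. by rewrite /limiting => ->. Qed.

(** Choosing once and for all a successor position for every answer, the position
reached is recovered from a history by replaying it. *)
Lemma Gamma_OD_of_plan (X : topologicalType) t q :
  Gamma_from t q [set: X] -> Gamma_OD t q X.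
Proof.
move=> [A Aw].
have [nxt nxtP] : {f : position A * (set X * set X) -> position A & forall r,
    valid r.1 -> OD_reply (calN t) r.2.1 r.2.2 (offer r.1) ->
    step r.1 r.2.1 r.2.2 (f r)}.
  apply: (@choice _ _ (fun r p' => valid r.1 ->
    OD_reply (calN t) r.2.1 r.2.2 (offer r.1) -> step r.1 r.2.1 r.2.2 p')).
  move=> -[p [V M]] /=.
  have [[vp rep]|no] :=
    pselect (valid p /\ OD_reply (calN t) V M (offer p)).
    by have [p' sp'] := wins_step Aw vp rep; exists p'.
  by exists p => vp rep; case: no.
pose state h := foldl (fun p (r : set X * (set X * set X)) => nxt (p, r.2))
  (start A) h.
exists (fun h => offer (state h)) => U V M U0 US.
pose p n := state (mkseq (fun i => (U i, (V i, M i))) n).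
have pS n : p n.+1 = nxt (p n, (V n, M n)).
  by rewrite /p /mkseq -addn1 iotaD map_cat /state foldl_cat.
have Up n : U n = offer (p n).
  by case: n => [|n]; rewrite ?US// U0 (wins_offer Aw).
have p_valid n :
    (forall i, i < n -> OD_reply (calN t) (V i) (M i) (U i)) -> valid (p n).
  elim: n => [|n IH] rep; first exact: wins_valid Aw.
  have [] // : step (p n) (V n) (M n) (p n.+1).
  rewrite pS; apply: (nxtP (p n, (V n, M n))) => /=.
    by apply: IH => i /ltnW; exact: rep.
  by rewrite -Up; exact: rep.
have p_step n : (forall i, i <= n -> OD_reply (calN t) (V i) (M i) (U i)) ->
    step (p n) (V n) (M n) (p n.+1).
  move=> rep; rewrite pS; apply: (nxtP (p n, (V n, M n))) => /=.
    by apply: p_valid => i /ltnW; exact: rep.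
  by rewrite -Up; exact: rep.
split=> [n /p_step[]|rep]; first by rewrite Up.
have pr : run t p V M by split=> // n; [rewrite -Up|exact: p_step].
apply/(@payoffP _ t q U) => //; last exact: wins_payoff Aw _ _ _ pr.
by move=> n; have [_ _ []] := run_step pr n; rewrite Up.
Qed.

(** Positions are the finite histories of plays that follow the strategy. *)
Lemma plan_of_Gamma_OD (X : topologicalType) t q :
  Gamma_OD t q X -> Gamma_from t q [set: X].
Proof.
move=> [s sw].
pose off h := if nilp h then [set: X] else s h.
pose H (V M : nat -> set X) := fix H n :=
  if n is m.+1 then rcons (H m) (off (H m), (V m, M m)) else [::].
have HE V M n : H V M n = mkseq (fun i => (off (H V M i), (V i, M i))) n.
  elim: n => // n IH.
  by rewrite /mkseq -addn1 iotaD map_cat cats1 -[map _ _]IH addn1.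
have HS V M n : off (H V M n.+1) = s (H V M n.+1).
  by rewrite /off /nilp /= size_rcons.
have sP V M := sw (fun n => off (H V M n)) V M erefl.
have {HS} sP V M := sP V M (fun n => etrans (HS V M n) (congr1 s (HE V M n.+1))).
pose legal V M n := forall i, i < n ->
  OD_reply (calN t) (V i) (M i) (off (H V M i)).
exists (@Plan X _ [::]
  (fun h => exists V M n, h = H V M n /\ legal V M n) off
  (fun h V M h' => h' = rcons h (off h, (V, M)))); split=> //=.
- by exists (fun=> setT), (fun=> setT), 0.
- move=> _ V' M' [V [M [n [-> VMn]]]] rep.
  (* Changed from index [n] on, the sequences have the new round at that index. *)
  pose V1 i := if i < n then V i else V'.
  pose M1 i := if i < n then M i else M'.
  have H1 i : i <= n -> H V1 M1 i = H V M i.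
    elim: i => //= i IH lt_in; rewrite IH; last exact: ltnW.
    by rewrite /V1 /M1 lt_in.
  have VM1 : legal V1 M1 n.+1.
    move=> i; rewrite ltnS leq_eqVlt => /predU1P[->|lt_in].
      by rewrite /V1 /M1 ltnn H1.
    by rewrite /V1 /M1 lt_in H1; [exact: VMn|exact: ltnW].
  have H1S : H V1 M1 n.+1 = rcons (H V M n) (off (H V M n), (V', M')).
    by rewrite /= H1// /V1 /M1 ltnn.
  exists (H V1 M1 n.+1); split=> //=; first by exists V1, M1, n.+1.
  have <- : V1 n = V' by rewrite /V1 ltnn.
  by apply: (sP V1 M1).1 => i; exact: VM1.
- move=> p V M pr.
  have pE n : p n = H V M n.
    elim: n => [|n IH]; first exact: run_start pr.
    by have [_ /= -> _] := run_step pr n; rewrite IH.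
  apply/(@payoffP _ t q (fun n => off (H V M n))).
  + by move=> n; rewrite -pE; exact: run_reply pr n.
  + by move=> n; rewrite -pE; have [_ _ []] := run_step pr n.
  + by apply: (sP V M).2 => n; rewrite -pE; exact: run_reply pr n.
Qed.

Lemma Gamma_ODP (X : topologicalType) t q :
  Gamma_OD t q X <-> Gamma_from t q [set: X].
Proof. by split; [exact: plan_of_Gamma_OD|exact: Gamma_OD_of_plan]. Qed.

(** * Comparison of the classes *)

Lemma nested_subset (T : Type) (V : nat -> set T) :
  (forall n, V n.+1 `<=` V n) -> forall m n, m <= n -> V n `<=` V m.
Proof.
move=> VS m n /subnK <-; elim: (n - m) => // k IH.
exact: subset_trans (VS _) IH.
Qed.

Lemma calN_p_points (X : topologicalType) (M : nat -> set X) :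
  (forall n, calN t_p (M n)) -> exists u : nat -> X, M = fun n => [set u n].
Proof. by move=> /choice[u Mu]; exists u; apply/funext. Qed.

Lemma limiting_sub (X : topologicalType) q (V M N : nat -> set X) :
  (forall n, M n `<=` N n) -> limiting q V M -> limiting q V N.
Proof.
move=> MN; case: q => /=.
  move=> [x [/upper_ltP Mx Vx]]; exists x; split=> //.
  apply/upper_ltP => O xO k; have [n kn [y [My Oy]]] := Mx O xO k.
  by exists n => //; exists y; split=> //; exact: MN.
by move=> [u Mu lim]; exists u => // n; exact: MN.
Qed.

Lemma limiting_k_l (X : topologicalType) (V M : nat -> set X) :
  limiting q_k V M -> limiting q_l V M.
Proof.
move=> [u Mu lim].
have [|p pstar _] := @exists_omega_star (nbhs \oo) _.
  by move=> k; exists k.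
have [x Vx ux] := lim p pstar.
by exists x; split=> //; exact: upper_lt_cvg ux.
Qed.

(** The points selected in the later rounds are completed arbitrarily in the first
[k] ones, which no limit along a free ultrafilter notices. *)
Lemma limiting_delay (X : topologicalType) q (V M : nat -> set X) k :
  (forall n, V n.+1 `<=` V n) -> (forall n, M n !=set0) ->
  limiting q (fun n => V (n + k)) (fun n => M (n + k)) -> limiting q V M.
Proof.
move=> VS Mn; have Vk x : (\bigcap_n V (n + k)) x -> (\bigcap_n V n) x.
  by move=> xV n _; apply: (nested_subset VS (leq_addr k n)); exact: xV.
case: q => /= [[x [Mx xV]]|[u Mu lim]].
  by exists x; split; [exact: upper_lt_shift Mx|exact: Vk].
have /choice[w Mw] := Mn.
exists (fun n => if n < k then w n else u (n - k)) => [n|p pstar].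
  by case: ltnP => // kn; rewrite -{1}(subnK kn).
have [x /Vk xV ux] := lim _ (omega_star_map k pstar); exists x => //.
by apply: cvg_delay pstar _ ux => n; rewrite ltnNge leq_addl addnK.
Qed.

Lemma calN_nonempty t (X : topologicalType) (M : set X) : calN t M -> M !=set0.
Proof. by case: t => [[]|[x ->]] //; exists x. Qed.

Lemma Gamma_OD_k_l t (X : topologicalType) : Gamma_OD t q_k X -> Gamma_OD t q_l X.
Proof.
move=> /Gamma_ODP[A [Av Ao As Ap]]; apply/Gamma_ODP; exists A; split=> //.
by move=> p V M pr /(Ap _ _ _ pr)/limiting_k_l.
Qed.

(** The plan for points is fed with a point chosen in each open answer. *)
Lemma Gamma_OD_p_o q (X : topologicalType) : Gamma_OD t_p q X -> Gamma_OD t_o q X.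
Proof.
move=> /Gamma_ODP[A [Av Ao As Ap]]; apply/Gamma_ODP.
exists (@Plan X _ (start A) (@valid _ A) (@offer _ A)
  (fun p V M p' => exists2 x, M x & moves_to p V [set x] p')); split=> //=.
- move=> p V M vp [VU [_ [x Mx]] MU].
  have [|p' [vp' np' op']] := As p V [set x] vp.
    by split=> //; [exists x|move=> _ ->; exact: MU].
  by exists p'; split=> //; exists x.
- move=> p V M pr.
  have /choice[x xP] n : exists x, M n x /\ moves_to (p n) (V n) [set x] (p n.+1).
    by have [_ [x] ? ? _] := run_step pr n; exists x.
  have pr' : run t_p p V (fun n => [set x n]).
    split=> [|n|n]; first exact: run_start pr.
      have [VU _ MU] := run_reply pr n; split=> //; first by exists (x n).
      by move=> _ ->; apply: MU; exact: (xP n).1.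
    by have [? _ ?] := run_step pr n; split=> //; exact: (xP n).2.
  by move=> /(Ap _ _ _ pr'); apply: limiting_sub => n _ ->; exact: (xP n).1.
Qed.

(** The sets [M n] are ignored while playing; as [M n.+1] is chosen in [U n.+1], it
lies in [V n], and this is all that a condition on the sequence [V] can see. *)
Lemma Gamma_OD_of_BM r t q (X : topologicalType) :
  (forall V M : nat -> set X, frakV_ r V -> (forall n, calN t (M n)) ->
     (forall n, M n.+1 `<=` V n) -> limiting q V M) ->
  Gamma_BM r X -> Gamma_OD t q X.
Proof.
move=> VrM [s sw].
exists (fun h => s [seq (x.1, x.2.1) | x <- h]) => U V M U0 US.
have {}US n : U n.+1 = s (mkseq (fun i => (U i, V i)) n.+1).
  by rewrite US /mkseq -map_comp.
have [legal win] := sw U V U0 US.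
split=> [n rep|rep]; first by apply: legal => i /rep[].
have {}win : (@frakV_ X r `|` @frakV_BM_star X) V.
  by apply: win => n; have [] := rep n.
have UV n : U n.+1 `<=` V n.
  have [] // : nonempty_open_in (U n.+1) (V n).
  by apply: legal => i _; have [] := rep i.
apply/(payoffP q rep UV) => Vn; case: win => [Vr|[Vf]]; last by case.
apply: VrM => // n; first by have [] := rep n.
by have [_ _] := rep n.+1; move/subset_trans; apply.
Qed.

Lemma limiting_frakV_t t (X : topologicalType) (V M : nat -> set X) :
  frakV_t t V -> (forall n, calN t (M n)) -> (forall n, M n.+1 `<=` V n) ->
  limiting q_l V M.
Proof.
move=> [_ Vt] NM MV; have [||_ [x [Mx Vx]]] := Vt (fun n => M (n + 1)).
- by move=> n; exact: NM.
- by move=> n; rewrite addn1; exact: MV.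
by exists x; split=> //; exact: (@upper_lt_shift _ M 1).
Qed.

Lemma limiting_frakV_k (X : topologicalType) (V M : nat -> set X) :
  frakV_k V -> (forall n, calN t_p (M n)) -> (forall n, M n.+1 `<=` V n) ->
  limiting q_k V M.
Proof.
move=> [[[_ VS] _] Vc Vout] /calN_p_points[u ->] MV; exists u => //.
apply: compact_attracts Vc _ => W Wo /(Vout W Wo)[k kW].
exists k.+1 => -[//|n]; rewrite ltnS => kn; apply: kW.
by apply: (nested_subset VS kn); exact: MV.
Qed.

(** * Products *)

Lemma open_setX (X Y : topologicalType) (A : set X) (B : set Y) :
  open A -> open B -> open (A `*` B).
Proof.
move=> Ao Bo; rewrite openE => -[x y] [/= Ax By].
by exists (A, B) => //=; split; exact: open_nbhs_nbhs.
Qed.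

Lemma calN_box t (X Y : topologicalType) (M : set (X * Y)) : calN t M ->
  exists M12 : set X * set Y,
    [/\ calN t M12.1, calN t M12.2 & M12.1 `*` M12.2 `<=` M].
Proof.
case: t => [[Mo [[x y] Mxy]]|[[x y] ->]]; last first.
  exists ([set x], [set y]); split; [by exists x|by exists y|].
  by move=> [a b] [/= -> ->].
move: Mo; rewrite openE => /(_ _ Mxy)[[A B] /= [Ax By] AB].
exists (A°, B°) => /=; split.
- by split; [exact: open_interior|exists x].
- by split; [exact: open_interior|exists y].
- by move=> [a b] [/interior_subset Aa /interior_subset Bb]; exact: AB.
Qed.

Lemma setX_subsetP (S T : Type) (A A' : set S) (B B' : set T) :
  A !=set0 -> B !=set0 -> A `*` B `<=` A' `*` B' -> A `<=` A' /\ B `<=` B'.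
Proof.
move=> [a Aa] [b Bb] AB; split=> [x Ax|y By].
  by have [] := AB (x, b) (conj Ax Bb).
by have [] := AB (a, y) (conj Aa By).
Qed.

Lemma OD_reply_box t (X Y : topologicalType) (U1 : set X) (U2 : set Y) V M :
  OD_reply (calN t) V M (U1 `*` U2) ->
  exists VM : (set X * set Y) * (set X * set Y),
    [/\ OD_reply (calN t) VM.1.1 VM.2.1 U1, OD_reply (calN t) VM.1.2 VM.2.2 U2,
        VM.1.1 `*` VM.1.2 `<=` V & VM.2.1 `*` VM.2.2 `<=` M].
Proof.
move=> [[Vo Vn VU] NM MU].
have [[V1 V2] /= [[V1o V1n] [V2o V2n] V12]] := @calN_box t_o _ _ V (conj Vo Vn).
have [[M1 M2] /= [NM1 NM2 M12]] := calN_box NM.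
have [VU1 VU2] := setX_subsetP V1n V2n (subset_trans V12 VU).
have [MU1 MU2] := setX_subsetP (calN_nonempty NM1) (calN_nonempty NM2)
  (subset_trans M12 MU).
by exists ((V1, V2), (M1, M2)); split.
Qed.

(** Along a free ultrafilter that sees the upper limit in [Y], the points chosen in
[X] converge. *)
Lemma upper_lt_setX (X Y : topologicalType) (M1 V1 : nat -> set X)
    (M2 V2 : nat -> set Y) :
  limiting q_k V1 M1 -> limiting q_l V2 M2 ->
  limiting q_l (fun n => V1 n `*` V2 n) (fun n => M1 n `*` M2 n).
Proof.
move=> [u Mu lim] [y [/upper_lt_ultra[p pstar Mp] Vy]].
have [x Vx ux] := lim p pstar; have [pU _] := pstar.
exists (x, y); split; last by move=> n _; split; [exact: Vx|exact: Vy].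
apply/upper_ltP => O [[A B] /= [/ux uA /Mp pB] AB] k.
have pA : p [set n | A (u n)] by [].
have [n kn [An [z [Mz Bz]]]] := omega_star_unbounded pstar (filterI pA pB) k.
by exists n => //; exists (u n, z); split=> //; exact: AB.
Qed.

Lemma Gamma_OD_setX t (X Y : topologicalType) :
  Gamma_OD t q_k X -> Gamma_OD t q_l Y -> Gamma_OD t q_l (X * Y)%type.
Proof.
move=> /Gamma_ODP[A Aw] /Gamma_ODP[B Bw]; apply/Gamma_ODP.
pose nxt (p : position A * position B) V M (p' : position A * position B) :=
  exists VM : (set X * set Y) * (set X * set Y),
   [/\ VM.1.1 `*` VM.1.2 `<=` V /\ VM.2.1 `*` VM.2.2 `<=` M,
       OD_reply (calN t) VM.1.1 VM.2.1 (offer p.1),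
       OD_reply (calN t) VM.1.2 VM.2.2 (offer p.2),
       step p.1 VM.1.1 VM.2.1 p'.1 & step p.2 VM.1.2 VM.2.2 p'.2].
exists (@Plan _ _ (start A, start B) (fun p => valid p.1 /\ valid p.2)
  (fun p => offer p.1 `*` offer p.2) nxt); split=> /=.
- by split; [exact: wins_valid Aw|exact: wins_valid Bw].
- by rewrite (wins_offer Aw) (wins_offer Bw) setXTT.
- move=> [p1 p2] V M /= [vp1 vp2] /OD_reply_box[VM [rep1 rep2 VV MM]].
  have [p1' sp1] := wins_step Aw vp1 rep1.
  have [p2' sp2] := wins_step Bw vp2 rep2.
  have [vp1' _ [w1 n1 i1]] := sp1; have [vp2' _ [w2 n2 i2]] := sp2.
  exists (p1', p2'); split=> //; first by exists VM.
  split; first exact: open_setX.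
    by case: n1 n2 => x ? [y ?]; exists (x, y).
  by apply: subset_trans VV => -[x y] [/i1 ? /i2 ?].
- move=> p V M pr.
  have /choice[VM VMP] n : exists VM, _ := let: And3 _ e _ := run_step pr n in e.
  have pr1 : run t (fun n => (p n).1) (fun n => (VM n).1.1) (fun n => (VM n).2.1).
    by split=> [|n|n]; [rewrite (run_start pr)|case: (VMP n)|case: (VMP n)].
  have pr2 : run t (fun n => (p n).2) (fun n => (VM n).1.2) (fun n => (VM n).2.2).
    by split=> [|n|n]; [rewrite (run_start pr)|case: (VMP n)|case: (VMP n)].
  move=> [[x y]]; rewrite -(run_offer pr) /= => xyo.
  have lim1 : limiting q_k (fun n => (VM n).1.1) (fun n => (VM n).2.1).
    apply: (wins_payoff Aw pr1); rewrite -(run_offer pr1); exists x => n _.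
    by have [] := xyo n I.
  have lim2 : limiting q_l (fun n => (VM n).1.2) (fun n => (VM n).2.2).
    apply: (wins_payoff Bw pr2); rewrite -(run_offer pr2); exists y => n _.
    by have [] := xyo n I.
  have [z [Mz Vz]] := upper_lt_setX lim1 lim2.
  apply: (@limiting_sub _ q_l _ (fun n => (VM n).2.1 `*` (VM n).2.2)).
    by move=> n; have [[]] := VMP n.
  exists z; split=> // n _; have [[VV _] _ _ _ _] := VMP n.
  by apply: VV; exact: Vz.
Qed.

Definition box (D : Type) (X : D -> Type) (A : forall d, set (X d)) :
  set (forall d, X d) := [set x | forall d, A d (x d)].

Lemma cvg_initial (S : choiceType) (T : topologicalType) (f : S -> T)
    (F : set_system S) (x : S) :
  Filter F -> f @ F --> f x -> F --> (x : initial_topology f).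
Proof.
move=> FF fx A [/= _ [[W Wo <-] Wx WA]]; apply: filterS WA _.
by apply: fx; exact: open_nbhs_nbhs.
Qed.

Lemma cvg_prod (D : Type) (X : D -> topologicalType) (p : set_system nat)
    (u : nat -> prod_topology X) (x : prod_topology X) :
  Filter p -> (forall d, (fun n => u n d) @ p --> x d) -> u @ p --> x.
Proof.
move=> pF ux; apply/cvg_sup => d; apply: cvg_initial.
exact: ux.
Qed.

Lemma open_box (D : Type) (X : D -> topologicalType) (A : forall d, set (X d))
    (F : set D) : finite_set F -> (forall d, open (A d)) ->
  (forall d, ~ F d -> A d = setT) -> @open (prod_topology X) (box A).
Proof.
elim/Pchoice: D => D in X A F *.
move=> /finite_fsetP[E ->] Ao AF; rewrite openE => x Ax.
have -> : box A =
    \bigcap_(d in [set` E]) ((fun y : prod_topology X => y d) @^-1` A d).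
  apply/seteqP; split=> y Ay d; first by move=> _; exact: Ay.
  by have [/Ay//|/AF ->] := pselect ([set` E] d).
apply: filter_bigI => d _; apply: (proj_continuous (i := d)).
by apply: open_nbhs_nbhs; split; [exact: Ao|exact: Ax].
Qed.

(** Boxes around [x] constrained at finitely many coordinates generate a filter that
converges to [x] at each coordinate, hence in the product. *)
Lemma nbhs_box (D : Type) (X : D -> topologicalType) (x : prod_topology X) O :
  nbhs x O -> exists (F : set D) (A : forall d, set (X d)),
    [/\ finite_set F, forall d, open (A d), forall d, ~ F d -> A d = setT,
        forall d, A d (x d) & box A `<=` O].
Proof.
elim/Pchoice: D => D in X x O *.
pose G : set_system (prod_topology X) :=
  [set O | exists (F : set D) (A : forall d, set (X d)),
    [/\ finite_set F, forall d, open (A d), forall d, ~ F d -> A d = setT,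
        forall d, A d (x d) & box A `<=` O]].
have GF : Filter G.
  split.
  - exists set0, (fun d => setT); split=> // d; exact: openT.
  - move=> O1 O2 [F1 [A1 [F1f A1o A1F A1x AO1]]] [F2 [A2 [F2f A2o A2F A2x AO2]]].
    exists (F1 `|` F2), (fun d => A1 d `&` A2 d); split.
    + by rewrite finite_setU.
    + by move=> d; exact: openI.
    + by move=> d /not_orP[/A1F -> /A2F ->]; rewrite setTI.
    + by move=> d; split.
    + by move=> y Ay; split; [apply: AO1|apply: AO2] => d; have [] := Ay d.
  - move=> O1 O2 O12 [F [A [Ff Ao AF Ax AO]]]; exists F, A; split=> //.
    exact: subset_trans O12.
suff : G --> x by apply.
apply/cvg_sup => d; apply: cvg_initial => W.
rewrite nbhsE => -[B [Bo Bx] BW].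
pose A := dfwith (fun d => [set: X d]) d B.
exists [set d], A; rewrite /A; split.
- exact: finite_set1.
- by move=> e; case: dfwithP => // ? _; exact: openT.
- by move=> e ne; rewrite dfwithout//; apply/eqP => de; exact: ne.
- by move=> e; case: dfwithP.
- by move=> y /(_ d); rewrite dfwithin => /BW.
Qed.

Lemma calN_prod_box t (D : Type) (X : D -> topologicalType)
    (M : set (prod_topology X)) : calN t M ->
  exists (F : set D) (m : forall d, set (X d)),
    [/\ finite_set F, forall d, calN t (m d), box m `<=` M &
        t = t_o -> forall d, ~ F d -> m d = setT].
Proof.
case: t => [[Mo [x Mx]]|[x ->]].
  have [F [A [Ff Ao AF Ax AM]]] := nbhs_box (open_nbhs_nbhs (conj Mo Mx)).
  by exists F, A; split=> // d; split=> //; exists (x d).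
exists set0, (fun d => [set x d]); split=> //; first by move=> d; exists (x d).
by move=> y yx; apply: functional_extensionality_dep => d; exact: yx.
Qed.

Lemma box_nonempty (D : Type) (X : D -> Type) (A : forall d, set (X d)) :
  (forall d, A d !=set0) -> box A !=set0.
Proof. by move=> An; exists (fun d => projT1 (cid (An d))) => d; case: cid. Qed.

Lemma box_subsetP (D : Type) (X : D -> Type) (A B : forall d, set (X d)) :
  (forall d, A d !=set0) -> box A `<=` box B -> forall d, A d `<=` B d.
Proof.
elim/Pchoice: D => D in X A B *.
move=> /box_nonempty[x Ax] AB d y Ay.
have /AB/(_ d) : box A (dfwith x d y) by move=> e; case: dfwithP.
by rewrite dfwithin.
Qed.

(** Until round [k] the plan waits at its start, where it offers the whole space:
those rounds remove no common point. *)
Lemma limiting_delayed_run (X : topologicalType) (A : plan X) t q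
    (p : nat -> position A) V M k :
  plan_wins t q [set: X] A -> (forall n, n <= k -> p n = start A) ->
  (forall n, OD_reply (calN t) (V n) (M n) (offer (p n))) ->
  (forall n, k <= n -> step (p n) (V n) (M n) (p n.+1)) ->
  \bigcap_n offer (p n) !=set0 -> limiting q (fun n => offer (p n)) M.
Proof.
move=> Aw p0 rep st [z pz].
have pr : run t (fun n => p (n + k)) (fun n => V (n + k)) (fun n => M (n + k)).
  by split=> [|n|n]; [exact: p0|exact: rep|apply: st; exact: leq_addl].
apply: (@limiting_delay _ _ _ _ k) => [n|n|].
- have [kn|nk] := leqP k n; last by rewrite [p n]p0 ?(wins_offer Aw)// ltnW.
  have [[_ _ VU] _ _] := rep n; have [_ _ [_ _ UV]] := st n kn.
  exact: subset_trans VU.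
- by have [_ /calN_nonempty] := rep n.
- apply: (limiting_bigcap (esym (run_offer pr))); apply: (wins_payoff Aw pr).
  by rewrite -(run_offer pr); exists z => n _; exact: pz.
Qed.

(** In the product, finitely many coordinates are in play at each round; a
coordinate enters when the opponent's sets first constrain it, or when [g] says so,
and until then its whole space is offered.  A coordinate that never enters must be
unconstrained by all the [M n], which is automatic when these are open, and is
excluded by letting [g] run through all coordinates otherwise. *)
Lemma Gamma_OD_prod t (D : Type) (X : D -> topologicalType) (g : nat -> set D) :
  (forall n, finite_set (g n)) -> (t = t_o \/ forall d, exists n, g n d) ->
  (forall d, Gamma_OD t q_k (X d)) -> Gamma_OD t q_k (prod_topology X).
Proof.
move=> gf tg Xk; apply/Gamma_ODP.
pose A d := projT1 (cid ((Gamma_ODP (X d) t q_k).1 (Xk d))).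
have Aw d : plan_wins t q_k [set: X d] (A d) by rewrite /A; case: cid.
pose pos := ((forall d, position (A d)) * set D * nat)%type.
pose nxt (p : pos) (V M : set (prod_topology X)) (p' : pos) :=
  [/\ p'.2 = p.2.+1, p.1.2 `|` g p.2 `<=` p'.1.2 &
   exists v m : forall d, set (X d), [/\ box v `<=` V /\ box m `<=` M,
     forall d, OD_reply (calN t) (v d) (m d) (offer (p.1.1 d)),
     forall d, p'.1.2 d -> step (p.1.1 d) (v d) (m d) (p'.1.1 d) &
     forall d, ~ p'.1.2 d -> t = t_o -> m d = setT]].
exists (@Plan (prod_topology X) pos (fun d => start (A d), set0, 0)
  (fun p => [/\ forall d, valid (p.1.1 d), finite_set p.1.2 &
     forall d, ~ p.1.2 d -> p.1.1 d = start (A d)])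
  (fun p => box (fun d => offer (p.1.1 d))) nxt); split=> /=.
- by split=> // d; exact: wins_valid (Aw d).
- by apply/seteqP; split=> // x _ d; rewrite (wins_offer (Aw d)).
- move=> [[p F] k] V M /= [vp Ff pF] [[Vo Vn VU] NM MU].
  have [F1 [v [F1f Nv vV vF]]] := @calN_prod_box t_o _ _ V (conj Vo Vn).
  have [F2 [m [F2f Nm mM mF]]] := calN_prod_box NM.
  have vU := box_subsetP (fun d => calN_nonempty (Nv d)) (subset_trans vV VU).
  have mU := box_subsetP (fun d => calN_nonempty (Nm d)) (subset_trans mM MU).
  pose F' := (F `|` g k) `|` (F1 `|` F2).
  have rep d : OD_reply (calN t) (v d) (m d) (offer (p d)).
    by have [? ?] := Nv d; split=> //; split=> //; exact: vU.
  have /= p'P d : {p' : position (A d) |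
      (F' d -> step (p d) (v d) (m d) p') /\ (~ F' d -> p' = start (A d))}.
    apply: cid; have [F'd|nF'd] := pselect (F' d); last by exists (start (A d)).
    by have [p' sp] := wins_step (Aw d) (vp d) (rep d); exists p'; split.
  pose p' d := projT1 (p'P d).
  have p'F d : F' d -> step (p d) (v d) (m d) (p' d).
    by rewrite /p'; case: (p'P d) => ? [].
  have p'nF d : ~ F' d -> p' d = start (A d).
    by rewrite /p'; case: (p'P d) => ? [].
  have off d : nonempty_open_in (offer (p' d)) (v d).
    have [/p'F[]//|nF'] := pselect (F' d).
    rewrite p'nF// (wins_offer (Aw d)) vF//; last first.
      by move=> F1d; apply: nF'; right; left.
    have [_ [x _]] := Nv d.
    by split=> //; [exact: openT|exists x].
  have F'f : finite_set F' by rewrite !finite_setU.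
  exists (p', F', k.+1); split=> /=.
  + split=> // d; have [/p'F[]//|/p'nF ->] := pselect (F' d).
    exact: wins_valid (Aw d).
  + split=> //=; first by move=> d; left.
    exists v, m; split=> // d nF' tE; apply: mF => // F2d.
    by apply: nF'; right; right.
  + split.
    * apply: (open_box F'f) => [d|d /p'nF ->]; last exact: wins_offer.
      by have [] := off d.
    * by apply: box_nonempty => d; have [] := off d.
    * by apply: subset_trans vV => x px d; have [_ _] := off d; apply.
- move=> p V M pr [z].
  rewrite -(run_offer pr) /= => zo.
  pose P d n := (p n).1.1 d; pose F n := (p n).1.2.
  have PF n d : ~ F n d -> P d n = start (A d).
    case: n => [|n]; first by rewrite /P (run_start pr).
    by have [[_ _ +] _ _] := run_step pr n; apply.
  have pn n : (p n).2 = n.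
    elim: n => [|n IH]; first by rewrite (run_start pr).
    by have [_ [-> _ _] _] := run_step pr n; rewrite IH.
  have FS n : F n `<=` F n.+1.
    by have [_ [_ FF _] _] := run_step pr n; move=> d Fd; apply: FF; left.
  have Fg n : g n `<=` F n.+1.
    have [_ [_ FF _] _] := run_step pr n; rewrite pn in FF.
    by move=> d gd; apply: FF; right.
  have F_mono m n : m <= n -> F m `<=` F n.
    by move=> /subnK <-; elim: (n - m) => // k IH; exact: subset_trans IH (FS _).
  have /choice[vm vmP] n : exists vm : (forall d, set (X d)) * (forall d, set (X d)),
     [/\ box vm.1 `<=` V n /\ box vm.2 `<=` M n,
     forall d, OD_reply (calN t) (vm.1 d) (vm.2 d) (offer (P d n)),
     forall d, F n.+1 d -> step (P d n) (vm.1 d) (vm.2 d) (P d n.+1) &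
     forall d, ~ F n.+1 d -> t = t_o -> vm.2 d = setT].
    by have [_ [_ _ [v [m vmP]]] _] := run_step pr n; exists (v, m).
  have lim d : limiting q_k (fun n => offer (P d n)) (fun n => (vm n).2 d).
    have zd : \bigcap_n offer (P d n) !=set0 by exists (z d) => n _; exact: zo.
    have rep n : OD_reply (calN t) ((vm n).1 d) ((vm n).2 d) (offer (P d n)).
      by have [_ + _ _] := vmP n; apply.
    (* If [d] never enters, the coordinate [z d] of the common point gives a constant
    sequence; otherwise it enters at the round [k] found below. *)
    have [[n Fn]|nF] := pselect (exists n, F n d); last first.
      exists (fun=> z d) => [n|f fstar]; last first.
        exists (z d); first by move=> n _; exact: zo.
        have [fU _] := fstar; exact: cvg_cst.
      case: tg => [tE|/(_ d)[k gk]]; last by case: nF; exists k.+1; exact: Fg gk.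
      by have [_ _ _ ->] := vmP n; move=> // Fn; case: nF; exists n.+1.
    have [k nFk FkS] : exists2 k, ~ F k d & F k.+1 d.
      elim: n Fn => [|n IH] FnS; first by move: FnS; rewrite /F (run_start pr).
      by have [/IH//|nFn] := pselect (F n d); exists n.
    apply: (limiting_delayed_run (Aw d) (k := k)) rep _ zd.
    + by move=> j jk; apply: PF => Fj; apply: nFk; exact: F_mono Fj.
    + move=> j kj; have [_ _ + _] := vmP j; apply.
      exact: F_mono FkS.
  have uP d := cid2 (lim d).
  exists (fun n d => s2val (uP d) n).
    move=> n; have [[_ mM] _ _ _] := vmP n; apply: mM => d.
    exact: (s2valP (uP d)).
  move=> f fstar; have [fU _] := fstar.
  have xP d := cid2 (s2valP' (uP d) f fstar).
  exists (fun d => s2val (xP d)).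
    by rewrite -(run_offer pr) => n _ d; exact: (s2valP (xP d)).
  by apply: cvg_prod => d; exact: (s2valP' (xP d)).
Qed.

(** * Open subspaces and local properties *)

Lemma limiting_preimage (X Y : topologicalType) (f : Y -> X) q
    (V M : nat -> set X) : continuous f ->
  limiting q (fun n => f @^-1` V n) (fun n => f @^-1` M n) -> limiting q V M.
Proof.
move=> fc; case: q => /= [[y [/upper_ltP My Vy]]|[u Mu lim]].
  exists (f y); split=> //; apply/upper_ltP => O /fc yO k.
  by have [n kn [z [Mz Oz]]] := My _ yO k; exists n => //; exists (f z).
exists (f \o u) => // p pstar; have [y Vy uy] := lim p pstar.
by exists (f y) => //; apply: cvg_comp uy _; exact: fc.
Qed.

Lemma set_valT (X : Type) (U : set X) x : U x -> exists y : U, set_val y = x.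
Proof. by move=> Ux; exists (SigSub (mem_set Ux)). Qed.

Lemma set_val_inj (X : Type) (U : set X) : injective (@set_val _ U).
Proof. exact: val_inj. Qed.

Lemma set_val_mem (X : Type) (U : set X) (y : U) : U (set_val y).
Proof. exact: set_valP. Qed.

Lemma limiting_image (X : topologicalType) (U : set X) q (V M : nat -> set U) :
  limiting q (fun n => set_val @` V n) (fun n => set_val @` M n) ->
  limiting q V M.
Proof.
have Vx x : (\bigcap_n set_val @` V n) x ->
    exists2 y, (\bigcap_n V n) y & set_val y = x.
  move=> xV; have [y _ yx] := xV 0 I; exists y => // n _.
  by have [z Vz] := xV n I; rewrite -yx => /set_val_inj <-.
case: q => /= [[x [/upper_ltP Mx /Vx[y Vy yx]]]|[u Mu lim]].
  exists y; split=> //; apply/upper_ltP => O [/= _ [[W Wo <-] + WO]] k.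
  rewrite /= yx => Wx.
  have [n kn [_ [[z Mz <-] Wz]]] := Mx W (open_nbhs_nbhs (conj Wo Wx)) k.
  by exists n => //; exists z; split=> //; exact: WO.
have /choice[w wP] n : exists w, M n w /\ set_val w = u n.
  by have [w] := Mu n; exists w.
exists w => [n|p pstar]; first exact: (wP n).1.
have [_ /Vx[y Vy <-] uy] := lim p pstar; exists y => //.
have [pU _] := pstar; apply: cvg_initial; apply: cvg_trans uy.
rewrite -[X in X --> _]/((fun n => set_val (w n)) @ p).
by rewrite (_ : (fun n => set_val (w n)) = u)//; apply/funext => n; exact: (wP n).2.
Qed.

Lemma set_val_image_open (X : topologicalType) (U O : set X) (A : set U) :
  open O -> O `<=` U -> open A -> open (O `&` set_val @` A).
Proof.
move=> Oo OU [W Wo <-]; rewrite (_ : _ `&` _ = O `&` W); first exact: openI.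
apply/seteqP; split=> x [Ox]; first by move=> [y Wy yx]; split=> //; rewrite -yx.
move=> Wx; split=> //; have [y yx] := set_valT (OU x Ox).
by exists y => //; rewrite /= yx.
Qed.

Lemma set_val_continuous (X : topologicalType) (U : set X) :
  continuous (set_val : U -> X).
Proof. exact: initial_continuous. Qed.

Lemma calN_preimage t (X : topologicalType) (U M : set X) :
  M `<=` U -> calN t M -> calN t (set_val @^-1` M : set U).
Proof.
move=> MU; case: t => [[Mo [x Mx]]|[x Mx]].
  split; first by exists M.
  by have [y yx] := set_valT (MU x Mx); exists y; rewrite /= yx.
have [|y yx] := @set_valT _ U x; first by apply: MU; rewrite Mx.
exists y; rewrite Mx -yx; apply/seteqP; split=> z /= => [/set_val_inj//|->//].
Qed.

Lemma calN_image t (X : topologicalType) (U : set X) (M : set U) :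
  open U -> calN t M -> calN t (set_val @` M).
Proof.
move=> Uo; case: t => [[Mo [x Mx]]|[x ->]]; last first.
  by exists (set_val x); rewrite image_set1.
split; last by exists (set_val x), x.
have -> : set_val @` M = U `&` set_val @` M.
  apply/seteqP; split=> [_ [y My <-]|x' []//].
  by split; [exact: set_val_mem|exists y].
exact: set_val_image_open.
Qed.

(** Since [U] need not be open, the sets offered by the plan of the subspace are cut
down to [O], which makes them open in [X]. *)
Lemma Gamma_from_subspace t q (X : topologicalType) (U O : set X) :
  open O -> O `<=` U -> Gamma_OD t q U -> Gamma_from t q O.
Proof.
move=> Oo OU /Gamma_ODP[A Aw].
exists (@Plan X (position A) (start A) (@valid _ A)
  (fun p => O `&` set_val @` offer p)
  (fun p V M p' => step p (set_val @^-1` V) (set_val @^-1` M) p')).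
have rep' (p : position A) V M : OD_reply (calN t) V M (O `&` set_val @` offer p) ->
    OD_reply (calN t) (set_val @^-1` V) (set_val @^-1` M) (offer p).
  move=> [[Vo Vn VU] NM MU].
  have sub B : B `<=` O `&` set_val @` offer p -> set_val @^-1` B `<=` offer p.
    by move=> BU y /BU[_ [z zp /set_val_inj <-]].
  have inU B : B `<=` O `&` set_val @` offer p -> B `<=` U.
    by move=> BU x /BU[/OU].
  have [Vo' Vn'] := @calN_preimage t_o _ _ _ (inU _ VU) (conj Vo Vn).
  by split; [split=> //; exact: sub|apply: calN_preimage NM; exact: inU|exact: sub].
split=> /=; first exact: wins_valid Aw.
- rewrite (wins_offer Aw); apply/seteqP; split=> [x []//|x Ox].
  by split=> //; have [y <-] := set_valT (OU x Ox); exists y.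
- move=> p V M vp rep; have [p' sp'] := wins_step Aw vp (rep' _ _ _ rep).
  have [vp' _ [Uo [y Uy] UV]] := sp'.
  have [[_ _ VO] _ _] := rep.
  exists p'; split=> //=; split; first exact: set_val_image_open.
    by exists (set_val y); split; [have [] := VO _ (UV y Uy)|exists y].
  by move=> _ [_ [z /UV Vz <-]].
- move=> p V M pr.
  have pr' : run t (p : nat -> position A) (fun n => set_val @^-1` V n)
      (fun n => set_val @^-1` M n).
    split=> [|n|n]; first exact: run_start pr.
      exact: rep' (run_reply pr n).
    by have [] := run_step pr n.
  move=> [x Vx]; apply: (limiting_preimage (@set_val_continuous X U)).
  apply: (wins_payoff Aw pr'); have [[_ _ VO] _ _] := run_reply pr 0.
  have [y yx] : exists y : U, set_val y = x.
    by apply: set_valT; apply: OU; have [] := VO x (Vx 0 I).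
  by exists y => n _; rewrite /= yx; exact: Vx.
Qed.

(** Offering traces on [O] only restricts the opponent, and from the second round on
the sets offered lie in [O] anyway. *)
Lemma Gamma_from_open t q (X : topologicalType) (W O : set X) :
  open O -> O `<=` W -> Gamma_from t q W -> Gamma_from t q O.
Proof.
move=> Oo OW [A Aw].
have rep' (p : position A) V M : OD_reply (calN t) V M (offer p `&` O) ->
    OD_reply (calN t) V M (offer p).
  by move=> [[Vo Vn +] NM]; rewrite !subsetI => -[VU _] [MU _].
exists (@Plan X (position A) (start A) (@valid _ A) (fun p => offer p `&` O)
  (@step _ A)); split=> /=.
- exact: wins_valid Aw.
- by rewrite (wins_offer Aw); apply/setIidPr.
- move=> p V M vp rep; have [p' sp'] := wins_step Aw vp (rep' _ _ _ rep).
  have [vp' _ [Uo [x Ux] UV]] := sp'; have [[_ _ VO] _ _] := rep.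
  exists p'; split=> //; split; first exact: openI.
    by exists x; split=> //; have [] := VO x (UV x Ux).
  by move=> y [/UV].
- move=> p V M pr.
  apply: (wins_payoff Aw (p := p : nat -> position A) (V := V) (M := M)).
  split=> [|n|n]; first exact: run_start pr.
    exact: rep' (run_reply pr n).
  by have [] := run_step pr n.
Qed.

Lemma Gamma_OD_open t q (X : topologicalType) (U : set X) :
  Gamma_OD t q X -> open U -> Gamma_OD t q U.
Proof.
move=> /Gamma_ODP/Gamma_from_open XU Uo.
have [A Aw] := XU U Uo (@subsetT _ U).
have rep' (p : position A) (V M : set U) :
    OD_reply (calN t) V M (set_val @^-1` offer p) ->
    OD_reply (calN t) (set_val @` V) (set_val @` M) (offer p).
  move=> [[Vo Vn VU] NM MU].
  have [Vo' Vn'] := @calN_image t_o _ _ _ Uo (conj Vo Vn).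
  split; [split=> //|exact: calN_image|].
    by move=> _ [y Vy <-]; exact: VU.
  by move=> _ [y My <-]; exact: MU.
apply/Gamma_ODP.
exists (@Plan U (position A) (start A) (@valid _ A) (fun p => set_val @^-1` offer p)
  (fun p V M p' => step p (set_val @` V) (set_val @` M) p')); split=> /=.
- exact: wins_valid Aw.
- by rewrite (wins_offer Aw); apply/seteqP; split=> // y _; exact: set_val_mem.
- move=> p V M vp rep; have [p' sp'] := wins_step Aw vp (rep' _ _ _ rep).
  have [vp' _ [Uo' [x Ux] UV]] := sp'.
  exists p'; split=> //; split; first by exists (offer p').
    by have [y Vy yx] := UV x Ux; exists y; rewrite /= yx.
  by move=> y /UV[z Vz /set_val_inj <-].
- move=> p V M pr.
  have pr' : run t (p : nat -> position A) (fun n => set_val @` V n)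
      (fun n => set_val @` M n).
    split=> [|n|n]; first exact: run_start pr.
      exact: rep' (run_reply pr n).
    by have [] := run_step pr n.
  move=> [y Vy]; apply/limiting_image/(wins_payoff Aw pr').
  by exists (set_val y) => n _; exists y => //; exact: Vy.
Qed.

(** Every nonempty open set [V] contains a nonempty open set from which some plan
[A V] wins; the first answer of the opponent selects which of these plans is
followed.  A position carries one position of every [A V], of which only the
selected one moves: keeping its index as a mere label avoids dependent equalities. *)
Lemma Gamma_OD_local t q (X : topologicalType) :
  (forall x : X, exists2 U : set X, nbhs x U & Gamma_OD t q U) -> Gamma_OD t q X.
Proof.
move=> Xloc; apply/Gamma_ODP.
have AP (V : set X) : exists A : plan X, open V -> V !=set0 ->
    exists2 O, nonempty_open_in O V & plan_wins t q O A.
  have [[Vo [x Vx]]|nV] := pselect (open V /\ V !=set0); last first.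
    exists (@Plan X unit tt (fun=> True) (fun=> setT) (fun _ _ _ _ => True)).
    by move=> ? ?; case: nV.
  have [U xU Uk] := Xloc x.
  have [||A Aw] := @Gamma_from_subspace t q X U (V `&` U°) _ _ Uk.
  - by apply: openI => //; exact: open_interior.
  - by move=> y [_ /interior_subset].
  exists A => _ _; exists (V `&` U°) => //; split.
  - by apply: openI => //; exact: open_interior.
  - by exists x.
  - by move=> y [].
pose A V := projT1 (cid (AP V)).
have Aw V : open V -> V !=set0 ->
    exists2 O, nonempty_open_in O V & plan_wins t q O (A V).
  by rewrite /A; case: cid.
pose pos := (option (set X) * (forall V, position (A V)))%type.
pose off (p : pos) := if p.1 is Some W then offer (p.2 W) else setT.
pose val (p : pos) :=
  if p.1 is Some W then [/\ open W, W !=set0 & valid (p.2 W)] else True.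
pose nxt (p : pos) V M (p' : pos) :=
  if p.1 is Some W then p'.1 = Some W /\ step (p.2 W) V M (p'.2 W)
  else p' = (Some V, fun V => start (A V)).
exists (@Plan X pos (None, fun V => start (A V)) val off nxt); split=> //.
- move=> [[W|] p] V M; rewrite /val /off /=; last first.
    move=> _ [[Vo Vn _] _ _]; have [U UV AV] := Aw V Vo Vn.
    exists (Some V, fun V => start (A V)).
    split=> //; last by rewrite /off /= (wins_offer AV).
    by split=> //; exact: wins_valid AV.
  move=> [Wo Wn vp] rep; have [U UW AW] := Aw W Wo Wn.
  have p'P V' : {p' : position (A V') | V' = W -> step (p V') V M p'}.
    apply: cid; have [->|] := pselect (V' = W); last by exists (start (A V')).
    by have [p' sp'] := wins_step AW vp rep; exists p'.
  pose p' V' := projT1 (p'P V').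
  have p'W : step (p W) V M (p' W) by rewrite /p'; case: (p'P W) => ? /= /(_ erefl).
  exists (Some W, p'); have [vp' _ op'] := p'W.
  by split.
- move=> p V M pr.
  have [[Vo Vn _] _ _] := run_reply pr 0; have [U UV AV] := Aw _ Vo Vn.
  have p1 : p 1 = (Some (V 0), fun V => start (A V)).
    by have [_ + _] := run_step pr 0; rewrite /= /nxt (run_start pr).
  have pS n : (p n.+1).1 = Some (V 0).
    elim: n => [|n IH]; first by rewrite p1.
    by have [_ + _] := run_step pr n.+1; rewrite /= /nxt IH => -[].
  have pr' : run t (fun n => (p (n + 1)).2 (V 0)) (fun n => V (n + 1))
      (fun n => M (n + 1)).
    split=> [|n|n]; first by rewrite p1.
      by have := run_reply pr (n + 1); rewrite /= {1}/off addn1 pS.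
    by have [_ + _] := run_step pr (n + 1); rewrite /= /nxt !addn1 pS => -[].
  move=> [x Vx]; apply: (@limiting_delay _ q V M 1) => [n|n|].
  + have [_ _ [_ _ oV]] := run_step pr n; have [[_ _ Vo'] _ _] := run_reply pr n.+1.
    exact: subset_trans oV.
  + by have [_ /calN_nonempty] := run_reply pr n.
  + by apply: (wins_payoff AV pr'); exists x => n _; exact: Vx.
Qed.

(** * Stationary strategies *)

Lemma Gamma_OD_stationary t q (X : topologicalType)
    (Q : nat -> set X -> set X -> Prop) :
  (forall n V, open V -> V !=set0 -> exists2 U, nonempty_open_in U V & Q n V U) ->
  (forall U V M : nat -> set X, (forall n, OD_reply (calN t) (V n) (M n) (U n)) ->
     (forall n, nonempty_open_in (U n.+1) (V n)) ->
     (forall n, Q n (V n) (U n.+1)) -> payoff q V M) ->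
  Gamma_OD t q X.
Proof.
move=> Qex Qpay; apply/Gamma_ODP.
exists (@Plan X (nat * set X) (0, setT) (fun=> True) snd
  (fun p V M p' => p'.1 = p.1.+1 /\ Q p.1 V p'.2)); split=> //=.
- move=> [n U] V M _ [[Vo Vn _] _ _]; have [U' UV QU] := Qex n V Vo Vn.
  by exists (n.+1, U').
- move=> p V M pr.
  have pn n : (p n).1 = n.
    elim: n => [|n IH]; first by rewrite (run_start pr).
    by have [_ [-> _] _] := run_step pr n; rewrite IH.
  apply: (Qpay (fun n => (p n).2)) => n; first exact: run_reply pr n.
    by have [] := run_step pr n.
  by have [_ [_ +] _] := run_step pr n; rewrite pn.
Qed.

(** The sets [U n] are those offered, [V n] the answers. *)
Definition interleaved (X : topologicalType) (U V : nat -> set X) : Prop :=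
  forall n, [/\ open (V n), V n `<=` U n & nonempty_open_in (U n.+1) (V n)].

Lemma interleaved_nested (X : topologicalType) (U V : nat -> set X) m n :
  interleaved U V -> m <= n -> U n `<=` U m.
Proof.
move=> UV; apply: nested_subset => k; have [_ VU [_ _ US]] := UV k.
exact: subset_trans VU.
Qed.

Lemma stationary_points q (X : topologicalType)
    (Q : nat -> set X -> set X -> Prop) :
  (forall n V, open V -> V !=set0 -> exists2 U, nonempty_open_in U V & Q n V U) ->
  (forall (U V : nat -> set X) (u : nat -> X), interleaved U V ->
     (forall n, U n (u n)) -> (forall n, Q n (V n) (U n.+1)) ->
     forall x, (\bigcap_n V n) x -> limiting q V (fun n => [set u n])) ->
  Gamma_OD t_p q X.
Proof.
move=> Qex Qlim; apply: Gamma_OD_stationary Qex _ => U V M rep UV QU.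
have [u ME] : exists u : nat -> X, M = fun n => [set u n].
  by apply: calN_p_points => n; have [] := rep n.
move=> [x Vx]; rewrite ME; apply: (Qlim U) Vx => // n.
  by have [[Vo _ VU] _ _] := rep n.
by have [_ _] := rep n; rewrite ME; apply.
Qed.

(** The map [e] is meant to be the identity or the embedding in a
compactification. *)
Lemma upper_lt_closure (X Y : topologicalType) (e : X -> Y)
    (U V M : nat -> set X) x :
  interleaved U V -> (forall n, M n `<=` U n) ->
  upper_lt (fun n => e @` M n) x -> forall n, closure (e @` U n) x.
Proof.
move=> UV MU /upper_ltP Mx n O /Mx/(_ n)[k nk [_ [[y My <-] Oy]]].
exists (e y); split=> //; exists y => //.
by apply: (interleaved_nested UV nk); exact: MU.
Qed.

Definition closure_in (X : topologicalType) (V U : set X) : Prop := closure U `<=` V.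

Lemma upper_lt_bigcap (X : topologicalType) (U V M : nat -> set X) :
  interleaved U V -> (forall n, M n `<=` U n) ->
  (forall n, closure_in (V n) (U n.+1)) -> upper_lt M `<=` \bigcap_n V n.
Proof.
move=> UV MU clU x Mx n _; apply: clU; rewrite -[U n.+1]image_id.
apply: (upper_lt_closure UV MU).
by rewrite (_ : (fun k => id @` M k) = M)//; apply/funext => k; rewrite image_id.
Qed.

Lemma limiting_k_closure (X : topologicalType) (U V : nat -> set X) (u : nat -> X) :
  interleaved U V -> (forall n, U n (u n)) ->
  (forall n, closure_in (V n) (U n.+1)) ->
  (forall p, omega_star p -> exists y : X, u @ p --> y) ->
  limiting q_k V (fun n => [set u n]).
Proof.
move=> UV Uu clU lim; exists u => // p pstar; have [y uy] := lim p pstar.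
exists y => //; apply: (upper_lt_bigcap UV (M := fun n => [set u n])) => //.
  by move=> n _ ->.
exact: upper_lt_cvg uy.
Qed.

Lemma limiting_l_closure (X : topologicalType) (U V : nat -> set X) (u : nat -> X) :
  interleaved U V -> (forall n, U n (u n)) ->
  (forall n, closure_in (V n) (U n.+1)) ->
  (exists y, upper_lt (fun n => [set u n]) y) ->
  limiting q_l V (fun n => [set u n]).
Proof.
move=> UV Uu clU [y uy]; exists y; split=> //.
by apply: (upper_lt_bigcap UV (M := fun n => [set u n])) => // n _ ->.
Qed.

Lemma limiting_k_base (X : topologicalType) (U V : nat -> set X) (u : nat -> X) x :
  interleaved U V -> (forall n, U n (u n)) -> (\bigcap_n V n) x ->
  (forall O, nbhs x O -> exists n, U n `<=` O) ->
  limiting q_k V (fun n => [set u n]).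
Proof.
move=> UV Uu Vx xU; exists u => // p pstar; exists x => // O /xU[n nO].
have [pU _] := pstar; suff : p (u @^-1` O) by [].
apply: filterS (omega_star_cofinite n pstar) => k nk.
by apply: nO; apply: (interleaved_nested UV nk); exact: Uu.
Qed.

Lemma quasi_regular_in (X : topologicalType) (V : set X) : quasi_regular X ->
  open V -> V !=set0 -> exists2 U, nonempty_open_in U V & closure_in V U.
Proof.
move=> Xqr Vo /(Xqr _ Vo)[U [Uo Un UV]]; exists U => //; split=> //.
exact: subset_trans (@subset_closure _ U) UV.
Qed.

Lemma closure_in_sub (X : topologicalType) (V U U' : set X) :
  U' `<=` U -> closure_in V U -> closure_in V U'.
Proof. by move=> UU'; apply: subset_trans; exact: closureS. Qed.

(** * Compactness properties *)

Lemma compact_Gamma_OD (X : topologicalType) :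
  quasi_regular X -> compact [set: X] -> Gamma_OD t_p q_k X.
Proof.
move=> Xqr Xc; apply: (@stationary_points _ _ (fun=> @closure_in X)).
  by move=> _ V; exact: quasi_regular_in.
move=> U V u UV Uu clU x _; apply: (limiting_k_closure UV Uu clU) => p pstar.
have [|y _ uy] := compact_attracts (u := u) Xc _ pstar; last by exists y.
by move=> W _ TW; exists 0 => n _; exact: TW.
Qed.

Lemma countably_compact_Gamma_OD (X : topologicalType) :
  quasi_regular X -> countably_compact [set: X] -> Gamma_OD t_p q_l X.
Proof.
move=> Xqr Xc; apply: (@stationary_points _ _ (fun=> @closure_in X)).
  by move=> _ V; exact: quasi_regular_in.
move=> U V u UV Uu clU x _; apply: (limiting_l_closure UV Uu clU).
have [|y _ uy] := countably_compact_attracts (u := u) Xc; last by exists y.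
by move=> W _ TW; exists 0 => n _; exact: TW.
Qed.

(** If no point were in the upper limit, the [M n] would form a locally finite
family of open sets, so one of them would occur infinitely often, and its points
would be in the upper limit after all. *)
Lemma feebly_compact_upper_lt (X : topologicalType) (M : nat -> set X) :
  feebly_compact X -> (forall n, open (M n)) -> (forall n, M n !=set0) ->
  upper_lt M !=set0.
Proof.
move=> Xfc Mo Mn; apply: contrapT => nM.
have Mfin : finite_set (range M).
  apply: Xfc => [_ [n _ <-]//|x].
  have : ~ upper_lt M x by move=> Mx; apply: nM; exists x.
  move=> /existsNP[W] /not_implyP[Wx /contrapT Wfin]; exists W => //.
  apply: sub_finite_set (finite_image M Wfin).
  by move=> _ [[n _ <-] MW]; exists n.
(* The indices are covered by the fibres of [M], so that one of them is infinite. *)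
apply: infinite_nat.
apply: (@sub_finite_set _ _ (\bigcup_(A in range M) (M @^-1` [set A]))).
  by move=> n _; exists (M n) => //; exists n.
apply: bigcup_finite => // A _; apply: contrapT => Ainf.
have [n MnA] := infinite_setN0 Ainf; have [x Mx] := Mn n; apply: nM; exists x.
apply/upper_ltP => W Wx k; have [m km MmA] := (infinite_natP _).1 Ainf k.
exists m => //; exists x; split; last exact: nbhs_singleton.
by rewrite /= in MmA MnA; rewrite MmA -MnA.
Qed.

Lemma feebly_compact_Gamma_OD (X : topologicalType) :
  quasi_regular X -> feebly_compact X -> Gamma_OD t_o q_l X.
Proof.
move=> Xqr Xfc; apply: (@Gamma_OD_stationary _ _ _ (fun=> @closure_in X)).
  by move=> _ V; exact: quasi_regular_in.
move=> U V M rep UV clU _.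
have [||x Mx] := @feebly_compact_upper_lt X M Xfc.
- by move=> n; have [_ []] := rep n.
- by move=> n; have [_ []] := rep n.
exists x; split=> //; apply: (@upper_lt_bigcap _ U) Mx => // n.
  by have [[]] := rep n.
by have [] := rep n.
Qed.

(** * Developments *)

Lemma developable_Gamma_OD (X : topologicalType) :
  developable X -> Gamma_OD t_p q_k X.
Proof.
move=> [G [Gcov Gst]].
apply: (@stationary_points _ _ (fun n _ U => exists2 A, G n A & U `<=` A)).
  move=> n V Vo [x Vx]; have [Go GT] := Gcov n.
  have [A GA Ax] : (\bigcup_(A in G n) A) x by rewrite GT.
  exists (V `&` A); last by exists A => // y [].
  by split; [apply: openI => //; exact: Go|exists x|move=> y []].
move=> U V u UV Uu UG x Vx; apply: (limiting_k_base UV Uu Vx) => W xW.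
have [_ /(_ W xW)[_ [n _ <-] stW]] := Gst x; exists n.+1.
have [A GA UA] := UG n; apply: (subset_trans UA); apply: subset_trans stW.
move=> y Ay; exists A => //; split=> //; apply: UA.
by have [_ VU _] := UV n.+1; exact/VU/Vx.
Qed.

Lemma metrizable_developable (R : realType) (X : topologicalType) :
  metrizable R X -> developable X.
Proof.
move=> [M [f [g [fK gK fc gc]]]].
pose r n : R := n.+1%:R^-1%R.
exists (fun n => [set f @^-1` (ball y (r n))° | y in [set: M]]).
have r0 n : (0 < r n)%R by rewrite /r invr_gt0 ltr0Sn.
have Go n A : [set f @^-1` (ball y (r n))° | y in [set: M]] A -> open A.
  by move=> [y _ <-]; apply: open_comp => [x _|]; [exact: fc|exact: open_interior].
have Gx n x : (f @^-1` (ball (f x) (r n))°) x by exact: nbhsx_ballx.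
split=> [n|x].
  split; first exact: Go.
  apply/seteqP; split=> // x _; exists (f @^-1` (ball (f x) (r n))°); last exact: Gx.
  by exists (f x).
split=> [_ [n _ <-]|W xW].
  split; first by apply: bigcup_open => A [GA _]; exact: Go GA.
  exists (f @^-1` (ball (f x) (r n))°); last exact: Gx.
  by split; [exists (f x)|exact: Gx].
have : nbhs (f x) (g @^-1` W) by apply: gc; rewrite fK.
move=> /nbhs_ballP[e /= e0 eW].
have [n] : exists n, (r n < e / 2)%R.
  have [n _ /(_ n (leqnn n)) rn] :=
    near_infty_natSinv_lt (PosNum (divr_gt0 e0 (ltr0n _ 2))).
  by exists n.
move=> rn; exists (st x [set f @^-1` (ball y (r n))° | y in [set: M]]).
  by exists n.
move=> z [_ [[y _ <-] /interior_subset yx] /interior_subset yz].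
rewrite -[z]fK; apply: eW.
rewrite [e]splitr; apply: (ball_triangle (y := y)).
  by apply: ball_sym; apply: le_ball yx; exact: ltW.
by apply: le_ball yz; exact: ltW.
Qed.

Lemma wDelta_Gamma_OD (X : topologicalType) :
  quasi_regular X -> wDelta_space X -> Gamma_OD t_p q_l X.
Proof.
move=> Xqr [G Gcov Gcl].
apply: (@stationary_points _ _
  (fun n V U => closure_in V U /\ exists2 A, G n A & U `<=` A)).
  move=> n V Vo Vn; have [U [Uo [x Ux] UV] clU] := quasi_regular_in Xqr Vo Vn.
  have [Go GT] := Gcov n.
  have [A GA Ax] : (\bigcup_(A in G n) A) x by rewrite GT.
  exists (U `&` A); last first.
    split; last by exists A => // y [].
    by apply: closure_in_sub clU => y [].
  split; [apply: openI => //; exact: Go|by exists x|by move=> y [/UV]].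
move=> U V u UV Uu UG x Vx; apply: (limiting_l_closure UV Uu) => [n|].
  by have [] := UG n.
have [|y uy] := Gcl x (fun n => u n.+1).
  move=> n; have [_ [A GA UA]] := UG n; exists A; last exact/UA/Uu.
  by split=> //; apply: UA; have [_ VU _] := UV n.+1; exact/VU/Vx.
exists y; apply/upper_ltP => W Wy k.
have [|_ [[n /= kn <-] Wn]] := uy ((fun n => u n.+1) @` [set n | k <= n]) W _ Wy.
  by exists k => // n /= kn; exists n.
by exists n.+1; [exact: leqW|exists (u n.+1)].
Qed.

(** * Networks and covers *)

(** A settled set that meets [U] is dense in it; unlike density this alternative can
always be reached by shrinking [U], and it survives further shrinking. *)
Definition settled (X : topologicalType) (A U : set X) : Prop :=
  A `&` U = set0 \/ U `<=` closure A.

Lemma settled_sub (X : topologicalType) (A U U' : set X) :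
  U' `<=` U -> settled A U -> settled A U'.
Proof.
move=> U'U [AU|UA]; [left|right]; last exact: subset_trans UA.
by apply/seteqP; split=> // x [Ax /U'U Ux]; rewrite -AU.
Qed.

Lemma settle (X : topologicalType) (A V : set X) : open V -> V !=set0 ->
  exists2 U, nonempty_open_in U V & settled A U.
Proof.
move=> Vo Vn; have [[U UV AU]|nU] :=
  pselect (exists2 U, nonempty_open_in U V & A `&` U = set0).
  by exists U => //; left.
exists V; first by split.
right=> x Vx W; rewrite nbhsE => -[G [Go Gx] GW].
apply: contrapT => nAW; apply: nU; exists (V `&` G).
  by split; [exact: openI|exists x|move=> y []].
apply/seteqP; split=> // y [Ay [Vy Gy]]; apply: nAW.
by exists y; split=> //; exact: GW.
Qed.

(** Near a point only finitely many members are involved; they are settled one after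
the other. *)
Lemma locally_finite_settle (X : topologicalType) (N : set (set X)) (V : set X) :
  locally_finite N -> open V -> V !=set0 ->
  exists2 U, nonempty_open_in U V & forall A, N A -> settled A U.
Proof.
move=> Nlf Vo [x Vx]; have [W Wx /finite_seqP[s Ns]] := Nlf x.
have [U [Uo Un UV] Us] : exists2 U, nonempty_open_in U (V `&` W°) &
    forall A, A \in s -> settled A U.
  elim: {Ns} s => [|A s [U [Uo Un UV] Us]].
    exists (V `&` W°) => //; split=> //; last by exists x.
    by apply: openI => //; exact: open_interior.
  have [U' [Uo' Un' UU'] AU'] := settle A Uo Un.
  exists U'; first by split=> //; exact: subset_trans UV.
  by move=> B; rewrite inE => /predU1P[->//|/Us]; exact: settled_sub.
exists U; first by split=> // y /UV[].
move=> A NA; have [AW|nAW] := pselect (A `&` W !=set0).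
  by apply: Us; have : [set` s] A by rewrite -Ns.
left; apply/seteqP; split=> // y [Ay /UV[_ /interior_subset Wy]].
by apply: nAW; exists y.
Qed.

(** A member [A] of the network between a common point [x] and a regular open
neighbourhood [G] of [x] meets [U n.+1] for all [n], hence is dense in one of them,
which then lies in the interior of the closure of [G], that is in [G]. *)
Lemma sigma_space_Gamma_OD (X : topologicalType) :
  semiregular X -> sigma_space X -> Gamma_OD t_p q_k X.
Proof.
move=> [B [_ Bx] Breg] [N Nlf Nnet].
apply: (@stationary_points _ _ (fun n _ U => forall A, N n A -> settled A U)).
  by move=> n V; exact: locally_finite_settle.
move=> U V u UV Uu UN x Vx; apply: (limiting_k_base UV Uu Vx) => W /Bx.
move=> [G [/Breg Greg Gx] GW].
have Go : open G by rewrite -Greg; exact: open_interior.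
have [N' N'N GN'] := Nnet _ Go.
move: (Gx); rewrite GN' => -[A N'A Ax].
have [n _ NA] := N'N _ N'A.
have AG : A `<=` G by rewrite GN'; exact: bigcup_sup.
exists n.+1; apply: subset_trans GW; rewrite -Greg.
have [_ VU _] := UV n.+1; have [_ _ [Uo _ _]] := UV n.
have [AU|UA] := UN n A NA.
  have : (A `&` U n.+1) x by split=> //; exact/VU/Vx.
  by rewrite AU.
apply: (subset_trans _ (interiorS (closureS AG))).
by rewrite -open_subsetE.
Qed.

Lemma countable_network_sigma (X : topologicalType) :
  has_countable_network X -> sigma_space X.
Proof.
move=> [N /countable_injP[f finj] Nnet].
exists (fun n => [set A | N A /\ f A = n]).
  move=> n x; exists setT; first exact: filterT.
  have [[A [NA fA]]|nA] := pselect (exists A, N A /\ f A = n).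
    apply: sub_finite_set (finite_set1 A) => A' [[NA' fA'] _].
    by apply: finj; rewrite ?inE// fA fA'.
  by apply: (sub_finite_set _ (finite_set0 _)) => A [NA _]; case: nA; exists A.
rewrite (_ : \bigcup_n _ = N)//; apply/seteqP; split=> [A [n _ []]//|A NA].
by exists (f A).
Qed.

Lemma discrete_locally_finite (X : topologicalType) (F : set (set X)) :
  discrete_family F -> locally_finite F.
Proof.
move=> Fd x; have [U Ux UF] := Fd x; exists U => //.
have [[A [FA AU]]|nA] := pselect (exists A, F A /\ A `&` U !=set0).
  by apply: sub_finite_set (finite_set1 A) => B [FB BU]; exact: UF.
by apply: (sub_finite_set _ (finite_set0 _)) => A [FA AU]; case: nA; exists A.
Qed.

(** A closed set that is dense in [U] contains [U].  So, for a member [A] of the cover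
through a common point, each member of the [F n] between [A] and an open set
contains some [U n.+1], and [A] attracts the points played. *)
Lemma Sigma_space_Gamma_OD q (X : topologicalType) (K : set X -> Prop) :
  (forall (U V : nat -> set X) (u : nat -> X) C, interleaved U V ->
     (forall n, U n (u n)) -> (forall n, closure_in (V n) (U n.+1)) -> K C ->
     (forall W, open W -> C `<=` W -> exists k, forall n, k <= n -> W (u n)) ->
     limiting q V (fun n => [set u n])) ->
  quasi_regular X -> Sigma_space_for K -> Gamma_OD t_p q X.
Proof.
move=> Klim Xqr [F [C [Fd Fcl CK CT CF]]].
apply: (@stationary_points _ _ (fun n V U => closure_in V U /\
  forall A, F n A -> settled A U)).
  move=> n V Vo Vn; have [U [Uo Un UV] clU] := quasi_regular_in Xqr Vo Vn.
  have [U' [Uo' Un' UU'] U'F] :=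
    locally_finite_settle (discrete_locally_finite (Fd n)) Uo Un.
  exists U'; first by split=> //; exact: subset_trans UV.
  by split=> //; exact: closure_in_sub clU.
move=> U V u UV Uu UF x Vx.
have [A CA Ax] : (\bigcup_(A in C) A) x by rewrite CT.
apply: (Klim U V u A) => //; first by move=> n; have [] := UF n.
  by have [] := CK A CA.
move=> W Wo AW; have [E [n _ FE] [AE EW]] := CF A W CA Wo AW.
have [_ /(_ E FE) EU] := UF n.
have UE : U n.+1 `<=` E.
  case: EU => [EU0|]; last by move: (Fcl n E FE) => /closure_id <-.
  have : (E `&` U n.+1) x.
    by split; [exact: AE|have [_ VU _] := UV n.+1; exact/VU/Vx].
  by rewrite EU0.
exists n.+1 => k nk; apply/EW/UE.
by apply: (interleaved_nested UV nk); exact: Uu.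
Qed.

Lemma strong_Sigma_Gamma_OD (X : topologicalType) :
  quasi_regular X -> strong_Sigma_space X -> Gamma_OD t_p q_k X.
Proof.
apply: Sigma_space_Gamma_OD => U V u C UV Uu clU Cc Cu.
apply: (limiting_k_closure UV Uu clU) => p pstar.
by have [y _ uy] := compact_attracts Cc Cu pstar; exists y.
Qed.

Lemma Sigma_Gamma_OD (X : topologicalType) :
  quasi_regular X -> Sigma_space X -> Gamma_OD t_p q_l X.
Proof.
apply: Sigma_space_Gamma_OD => U V u C UV Uu clU Cc Cu.
apply: (limiting_l_closure UV Uu clU).
by have [y _ uy] := countably_compact_attracts Cc Cu; exists y.
Qed.

(** * Spaces embedded in a compactification *)

(** Every [V] is the trace of an open set [E] of the compactification, and the next
[U] is chosen with closure inside [E] and inside a member [A] of the cover.  A limit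
in the compactification then lies in the stars of any common point, hence in [X],
and in all the sets [E], hence in all the [V]. *)
Lemma p_space_Gamma_OD (X : topologicalType) : p_space X -> Gamma_OD t_p q_k X.
Proof.
move=> [_ [B [e [[[Bc Bh] _ eo _ _] [G [Go Gcov Gst]]]]]].
have eoP (A : set X) : open A <-> exists2 E : set B, open E & e @^-1` E = A.
  by rewrite -[open A]/((@open X) A) eo.
apply: (@stationary_points _ _ (fun n V U => exists E A, [/\ open E,
  e @^-1` E = V, G n A & closure (e @` U) `<=` E `&` A])).
  move=> n V /eoP[E Eo <-] [x /= Ex].
  have [A GA Ax] : (\bigcup_(A in G n) A) (e x) by apply: Gcov; exists x.
  have [|W Wx WOA] := @compact_regular B (e x) setT Bh Bc filterT (E `&` A).
    by apply: open_nbhs_nbhs; split=> //; apply: openI => //; exact: Go GA.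
  have clW : closure (e @` (e @^-1` W°)) `<=` E `&` A.
    apply: subset_trans WOA; apply: closureS => _ [y + <-].
    exact: interior_subset.
  exists (e @^-1` W°); last by exists E, A.
  split; first by apply/eoP; exists W° => //; exact: open_interior.
    by exists x.
  move=> y Wy; have [] // : (E `&` A) (e y).
  by apply/clW/subset_closure; exists y.
move=> U V u UV Uu UG x Vx; exists u => // p pstar; have [pU _] := pstar.
have [|b _ ub] := compact_attracts (u := e \o u) Bc _ pstar.
  by move=> W _ TW; exists 0 => n _; exact: TW.
have bU n : closure (e @` U n) b.
  apply: (upper_lt_closure UV (M := fun n => [set u n])); first by move=> k _ ->.
  by apply: upper_lt_cvg ub => // k; exists (u k).
have Ux n : U n x by have [_ VU _] := UV n; exact/VU/Vx.
have [y _ yb] : range e b.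
  suff /Gst : (\bigcap_n st (e x) (G n)) b by [].
  move=> n _; have [E [A [_ _ GA UOA]]] := UG n; exists A.
    split=> //; have [] := UOA (e x) => //.
    by apply: subset_closure; exists x.
  by have [] := UOA b (bU n.+1).
exists y.
  move=> n _; have [E [A [_ <- _ UOA]]] := UG n.
  by rewrite /= yb; have [] := UOA b (bU n.+1).
move=> W; rewrite nbhsE => -[W' [/eoP[E Eo <-] Ey] OW].
have pE : p ((e \o u) @^-1` E).
  by apply: ub; apply: open_nbhs_nbhs; split=> //; rewrite -yb.
suff : p (u @^-1` W) by [].
by apply: filterS pE => n; exact: OW.
Qed.

(** * Inclusions, permanence and examples of the classes *)

Theorem theorem4 (R : realType) :
  (* (1) *)
  ((forall X : topologicalType, Gamma_BM r_o X -> Gamma_OD t_o q_l X) /\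
   (forall X : topologicalType, Gamma_BM r_k X -> Gamma_OD t_p q_k X) /\
   (forall X : topologicalType, Gamma_BM r_p X -> Gamma_OD t_p q_l X) /\
   (forall X : topologicalType, Gamma_OD t_p q_k X -> Gamma_OD t_o q_k X) /\
   (forall X : topologicalType, Gamma_OD t_p q_k X -> Gamma_OD t_p q_l X) /\
   (forall X : topologicalType, Gamma_OD t_o q_k X -> Gamma_OD t_o q_l X) /\
   (forall X : topologicalType, Gamma_OD t_p q_l X -> Gamma_OD t_o q_l X)) /\
  (* (2) *)
  (forall (t : tkind) (X Y : topologicalType),
     Gamma_OD t q_k X -> Gamma_OD t q_l Y -> Gamma_OD t q_l (X * Y)%type) /\
  (* (3) *)
  (forall (D : Type) (X : D -> topologicalType),
     (forall d, Gamma_OD t_o q_k (X d)) ->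
     Gamma_OD t_o q_k (prod_topology X)) /\
  (* (4) *)
  (forall X : nat -> topologicalType,
     (forall n, Gamma_OD t_p q_k (X n)) ->
     Gamma_OD t_p q_k (prod_topology X)) /\
  (* (5) *)
  (forall (t : tkind) (q : qkind) (X : topologicalType) (U : set X),
     Gamma_OD t q X -> open U -> Gamma_OD t q (set_type U)) /\
  (* (6) *)
  (forall (t : tkind) (q : qkind) (X : topologicalType),
     (forall x : X, exists2 U : set X, nbhs x U & Gamma_OD t q (set_type U)) ->
     Gamma_OD t q X) /\
  (* (7) *)
  (forall X : topologicalType, quasi_regular X ->
     (metrizable R X \/ moore_space X \/ developable X \/
      (semiregular X /\ sigma_space X) \/
      (semiregular X /\ has_countable_network X) \/
      compact [set: X] \/ p_space X \/
      (semiregular X /\ strong_Sigma_space X) ->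
      Gamma_OD t_p q_k X) /\
     (countably_compact [set: X] \/
      (semiregular X /\ Sigma_space X) \/
      wDelta_space X ->
      Gamma_OD t_p q_l X) /\
     (feebly_compact X -> Gamma_OD t_o q_l X)).
Proof.
split.
  split; first by move=> X; apply: Gamma_OD_of_BM; exact: limiting_frakV_t.
  split; first by move=> X; apply: Gamma_OD_of_BM; exact: limiting_frakV_k.
  split; first by move=> X; apply: Gamma_OD_of_BM; exact: limiting_frakV_t.
  split; first exact: Gamma_OD_p_o.
  split; first exact: Gamma_OD_k_l.
  split; first exact: Gamma_OD_k_l.
  exact: Gamma_OD_p_o.
split; first exact: Gamma_OD_setX.
split.
  by move=> D X; apply: (@Gamma_OD_prod _ _ _ (fun=> set0)); [|left].
split.
  move=> X; apply: (@Gamma_OD_prod _ _ _ (fun n => [set n])).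
    by move=> n; exact: finite_set1.
  by right=> d; exists d.
split; first exact: Gamma_OD_open.
split; first exact: Gamma_OD_local.
move=> X Xqr; split.
  case=> [/metrizable_developable|]; first exact: developable_Gamma_OD.
  case=> [[_]|]; first exact: developable_Gamma_OD.
  case; first exact: developable_Gamma_OD.
  case=> [[]|]; first exact: sigma_space_Gamma_OD.
  case=> [[Xsr /countable_network_sigma]|]; first exact: sigma_space_Gamma_OD.
  case; first exact: compact_Gamma_OD.
  case; first exact: p_space_Gamma_OD.
  by move=> [_]; exact: strong_Sigma_Gamma_OD.
split; last exact: feebly_compact_Gamma_OD.
case; first exact: countably_compact_Gamma_OD.
case; first by move=> [_]; exact: Sigma_Gamma_OD.
exact: wDelta_Gamma_OD.
Qed.
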